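(* In the setting and with the notation of the context, assume $\sum_{i=0}^N\mu_i<\infty$. Then for $$\lambda_1=\inf\{D(f):\ \mu(f)=0,\ \mu(f^2)=1\}$$ the following variational formulas hold. (1) Difference form: $\displaystyle\inf_{v\in\widetilde{\mathscr V}}\ \sup_{0\le i<N}\widetilde R_i(v)=\lambda_1=\sup_{v\in\mathscr V}\ \inf_{0\le i<N}R_i(v).$ (2) Summation form: $\displaystyle\inf_{f\in\widetilde{\mathscr F}_I\cup\widetilde{\mathscr F}_I'}\ \sup_{1\le i\in E}I_i(\bar f)^{-1}=\lambda_1=\sup_{f\in\mathscr F_I}\ \inf_{1\le i\in E}I_i(\bar f)^{-1},$ where $\bar f=f-\pi(f)$.
   Context: Setting. $E=\{i\in\mathbb Z:0\le i<N+1\}$, $1\le N\le\infty$; birth rates $b_i>0$ for $0\le i<N$ and $b_N=0$ if $N<\infty$; death rates $a_i>0$ for $1\le i\in E$, $a_0=0$. $\mu_0=1$, $\mu_n=\frac{b_0\cdots b_{n-1}}{a_1\cdots a_n}$; $\mu(f)=\sum_{i\in E}\mu_if_i$; $Z=\sum_{i\in E}\mu_i$, $\pi=\mu/Z$. $D(f)=\sum_{1\le i<N+1}\mu_ia_i(f_i-f_{i-1})^2$ with domain $\{f\in L^2(\mu):D(f)<\infty\}$. Operators (convention $1/0=\infty$): - $I_i(f)=\frac1{\mu_ia_i(f_i-f_{i-1})}\sum_{j=i}^N\mu_jf_j$ for $1\le i\in E$. - $R_i(v)=a_{i+1}+b_i-a_i/v_{i-1}-b_{i+1}v_i$ for $0\le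 i<N$, where $v_{-1}>0$ is free (irrelevant as $a_0=0$) and, if $N<\infty$, $v_{N-1}$ is free (irrelevant as $b_N=0$). - For $v\in\widetilde{\mathscr V}$ (below) with support $\{0,1,\dots,m-2\}$, $\widetilde R_i(v)$ is $R_i(v)$ with $a_m$ replaced by $\tilde a_m=\mu_ma_m\big/\sum_{k=m}^N\mu_k$; by the convention $1/0=\infty$, $\widetilde R_i(v)=-\infty$ for $i\ge m$. Sets: - $\mathscr V=\{v:v_i>0\text{ for all }i\text{ with }0\le i<N-1\}$. - $\widetilde{\mathscr V}=\bigcup_{m=2}^{N}\big\{v:\ \frac{a_{i+1}}{a_{i+2}+b_{i+1}}<v_i<\frac{a_{i+1}+b_i-a_i/v_{i-1}}{b_{i+1}}\text{ for }i=0,1,\dots,m-2,\text{ and }v_i=0\text{ for }i\ge m-1\big\}$ (the union is over finite $m\ge 2$ if $N=\infty$). - $\mathscr F_I=\{f:f_0=0,\ f_i>0\text{ for }1\le i\in E,\ f\text{ strictly increasing}\}$. - $\widetilde{\mathscr F}_I=\{f:f_0=0,\text{ and there is }m\in E,\,m\ge1,\text{ with }f_i=f_{i\wedge m}>0\text{ for }1\le i\in E\text{ and }f\text{ strictly increasing on }\{1,\dots,m\}\}$. - $\widetilde{\mathscr F}_I'=\{f\in L^2(\mu):f_0=0,\ f\text{ strictly increasing}\}$.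
   Formalization: The first equality in (1), between the infimum over Ṽ and λ₁, is stated only for N ≠ 1: when N = 1 the set Ṽ is empty, so that infimum is +∞ while λ₁ = a₁ + b₀ is finite; all other equalities include N = 1. *)

(* Defs.v *)
From HB Require Import structures.
From mathcomp Require Import all_boot all_order all_algebra.
From mathcomp Require Import all_classical all_reals all_analysis.

Set Implicit Arguments.
Unset Strict Implicit.
Unset Printing Implicit Defensive.

Import Order.TTheory GRing.Theory Num.Theory.
Import numFieldNormedType.Exports.

Local Open Scope classical_set_scope.
Local Open Scope ring_scope.

(* The top N of the state space ranges over 1, 2, ..., oo: [Some n] is the
   finite value n and [None] is oo.  [leN i N] is [i < N + 1], that is, i
   belongs to E; [ltN i N] is [i < N].  Sequences indexed by E are functions
   on nat whose values outside E are never used. *)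
Definition leN (i : nat) (N : option nat) : bool :=
  if N is Some n then (i <= n)%N else true.
Definition ltN (i : nat) (N : option nat) : bool :=
  if N is Some n then (i < n)%N else true.

Section BirthDeath.
Context {R : realType}.
Variables (N : option nat) (b a : nat -> R).
Implicit Types (f v : nat -> R) (i m : nat).

Definition mu (n : nat) : R :=
  (\prod_(i < n) b i) / (\prod_(i < n) a i.+1).

Definition total_mass : \bar R := (\sum_(0 <= i <oo | leN i N) (mu i)%:E)%E.

Definition pi_ (i : nat) : R := mu i / fine total_mass.

(* Limits of partial sums; they are only used where the series converges
   absolutely or has nonnegative terms on E. *)
Definition mu_int f : \bar R :=
  (\sum_(0 <= i <oo | leN i N) (mu i * f i)%:E)%E.
Definition pi_int f : \bar R :=
  (\sum_(0 <= i <oo | leN i N) (pi_ i * f i)%:E)%E.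

Definition inL2 f : Prop := (mu_int (fun i => f i ^+ 2)%R < +oo)%E.

Definition dirichlet f : \bar R :=
  (\sum_(1 <= i <oo | leN i N) (mu i * a i * (f i - f i.-1) ^+ 2)%:E)%E.

Definition dirichlet_dom f : Prop := inL2 f /\ (dirichlet f < +oo)%E.

Definition lambda1 : \bar R :=
  ereal_inf [set dirichlet f | f in [set f | [/\ dirichlet_dom f,
    mu_int f = 0%E & mu_int (fun i => f i ^+ 2) = 1%E]]].

(* The death rates are a separate argument [d], since they are modified below.
   The term d_0 / v_{-1} is 0; for i >= 1 the quotient is taken in \bar R,
   where 0^-1 = +oo, so the value is -oo when d_i > 0 and v_{i-1} = 0. *)
Definition opR (d v : nat -> R) i : \bar R :=
  ((d i.+1 + b i)%:E
   - (if i is j.+1 then (d i)%:E / (v j)%:E else 0)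
   - (b i.+1 * v i)%:E)%E.

Definition setV : set (nat -> R) := [set v | forall i, ltN i.+1 N -> 0 < v i].

Definition a_tilde m : nat -> R := fun k =>
  if k == m
  then mu m * a m / fine (\sum_(m <= j <oo | leN j N) (mu j)%:E)%E
  else a k.

Definition opRt m v i : \bar R := opR (a_tilde m) v i.

Definition setVt_at m : set (nat -> R) :=
  [set v | (forall i, (i.+2 <= m)%N ->
              a i.+1 / (a i.+2 + b i.+1) < v i /\
              v i < (a i.+1 + b i - (if i is j.+1 then a i / v j else 0))
                    / b i.+1)
         /\ (forall i, (m <= i.+1)%N -> v i = 0)].

(* The union of the sets [setVt_at m], 2 <= m <= N, where each v is kept with
   its m, on which R~ depends.  This m is unique: every v in [setVt_at m] has
   support {0, ..., m - 2}. *)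
Definition setVt : set (nat * (nat -> R)) :=
  [set mv | [/\ (2 <= mv.1)%N, leN mv.1 N & setVt_at mv.1 mv.2]].

(* The mean is taken in \bar R because a function in [setFI] need not be
   integrable; then pi(f) = +oo and f - pi(f) is identically -oo. *)
Definition fbar f : nat -> \bar R := fun i => ((f i)%:E - pi_int f)%E.

(* If pi(f) is finite, the increments of fbar f are those of f, and a zero
   increment contributes the factor 0^-1 = +oo.  If pi(f) = +oo, then
   opI (fbar f) i = (-oo) * (-oo) = +oo for i >= 1, whose inverse is 0; this is
   also what the sum over j >= i gives when rewritten as
   sum_{j < i} mu_j (pi(f) - f_j). *)
Definition opI (g : nat -> \bar R) i : \bar R :=
  (((mu i * a i)%:E * (g i - g i.-1))^-1
   * \sum_(i <= j <oo | leN j N) ((mu j)%:E * g j))%E.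

Definition incr_on (P : pred nat) f : Prop :=
  forall i j, P i -> P j -> (i < j)%N -> f i < f j.

Definition setFI : set (nat -> R) :=
  [set f | [/\ f 0%N = 0, forall i, (1 <= i)%N -> leN i N -> 0 < f i
             & incr_on (leN ^~ N) f]].

Definition setFIt : set (nat -> R) :=
  [set f | f 0%N = 0 /\
     exists m, [/\ leN m N, (1 <= m)%N,
       forall i, (1 <= i)%N -> leN i N -> f i = f (minn i m) /\ 0 < f i
       & incr_on (fun i => (1 <= i <= m)%N) f]].

Definition setFIt' : set (nat -> R) :=
  [set f | [/\ inL2 f, f 0%N = 0 & incr_on (leN ^~ N) f]].

End BirthDeath.

(* Main.v *)
Require Import Defs.
From HB Require Import structures.
From mathcomp Require Import all_boot all_order all_algebra.
From mathcomp Require Import all_classical all_reals all_analysis.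
From mathcomp Require Import ring lra.

Import Order.TTheory GRing.Theory Num.Theory.
Import numFieldNormedType.Exports.

(* Write [w] for the increments of [f] and [kappa i = mu i * a i].  Summation by
   parts turns [lambda1] into the bottom of the form [s |-> sum (s_{j+1} - s_j)^2
   / mu j] on edge functions [s] vanishing at both ends, relative to the weight
   [1 / kappa]; there [kappa * w] for a positive [w] with [R(v) >= lam],
   [v i = w (i+2) / w (i+1)], is a positive supersolution, and a Hardy inequality
   gives [lam <= lambda1].  Conversely [kappa * w <= lam * S], with [S i] the sum
   of [mu j * (f j - pi(f))] over [j >= i], gives [D(f) <= lam * Var(f)].
   Taking [w = S / kappa] identifies [R] (and, for functions stopped at [m],
   [R~]) with [I^-1], so the two forms are linked.  Sharpness comes from shooting
   [- L phi = lam * phi] from [phi 0 = -1]: either all fluxes stay positive and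
   [phi + 1] witnesses [lam <= inf I^-1], or [phi] stopped where the flux first
   fails to be positive witnesses [sup I^-1 <= lam]. *)

Local Open Scope classical_set_scope.
Local Open Scope ring_scope.

(** * Summation by parts and the Picone inequality *)

Lemma sum_by_parts {R : realType} (T x : nat -> R) n :
  \sum_(0 <= j < n.+1) T j * (x j.+1 - x j) =
  T n * x n.+1 - T 0%N * x 0%N + \sum_(0 <= i < n) x i.+1 * (T i - T i.+1).
Proof.
elim: n => [|n IHn]; first by rewrite big_nat1 big_geq //; ring.
by rewrite big_nat_recr //= IHn [in RHS]big_nat_recr //=; ring.
Qed.

(** The two sides differ by the nonnegative term [h * k * (t / k - s / h) ^ 2]. *)
Lemma picone {R : realType} (h k s t : R) : 0 < h -> 0 < k ->
  (k - h) * (t ^+ 2 / k - s ^+ 2 / h) <= (t - s) ^+ 2.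
Proof.
move=> h0 k0; rewrite -subr_ge0.
have -> : (t - s) ^+ 2 - (k - h) * (t ^+ 2 / k - s ^+ 2 / h)
    = h * k * (t / k - s / h) ^+ 2.
  by field; rewrite !gt_eqF.
by rewrite mulr_ge0 ?sqr_ge0 // mulr_ge0 // ltW.
Qed.

Lemma leN_ltN i N : leN i.+1 N = ltN i N.
Proof. by case: N. Qed.

Lemma ltNW i N : ltN i N -> leN i N.
Proof. by case: N => // n /ltnW. Qed.

Lemma leN_trans {N} i j : (i <= j)%N -> leN j N -> leN i N.
Proof. by case: N => // n; exact: leq_trans. Qed.

(** * The reversible measure and the edge weights *)

Section BirthDeath.
Context {R : realType} (N : option nat) (b a : nat -> R).
Hypotheses (N_ge1 : leN 1 N)
  (b_gt0 : forall i, ltN i N -> 0 < b i)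
  (b_top : forall n, N = Some n -> b n = 0)
  (a_gt0 : forall i, (1 <= i)%N -> leN i N -> 0 < a i)
  (a_0 : a 0%N = 0)
  (mass_fin : (total_mass N b a < +oo)%E).

Local Notation mu := (mu b a).

Definition kappa i : R := mu i * a i.

Lemma mu0 : mu 0%N = 1.
Proof. by rewrite /Defs.mu !big_ord0 divr1. Qed.

(** Detailed balance, which makes [kappa i.+1] the conductance of the edge between [i] and
    [i.+1]. *)
Lemma kappaS i : ltN i N -> kappa i.+1 = mu i * b i.
Proof.
move=> iN; have /lt0r_neq0 ai : 0 < a i.+1 by apply: a_gt0; rewrite ?leN_ltN.
rewrite /kappa /Defs.mu !big_ord_recr /= invfM -!mulrA (mulVf ai) mulr1.
by ring.
Qed.

Lemma mu_gt0 i : leN i N -> 0 < mu i.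
Proof.
move=> iN; rewrite /Defs.mu divr_gt0 // prodr_gt0 // => -[j /= ji] _.
  by apply: b_gt0; rewrite -leN_ltN; exact: leN_trans iN.
by apply: a_gt0 => //; exact: leN_trans iN.
Qed.

(** Past a finite top the product defining [mu] contains the factor [b N = 0]. Sums over E weighted
    by [mu] can therefore be written without the condition [leN i N]. *)
Lemma mu_out i : ~~ leN i N -> mu i = 0.
Proof.
case E : N => [n|] //=; rewrite -ltnNge => ni.
by rewrite /Defs.mu (bigD1 (Ordinal ni)) //= (b_top _ E) !mul0r.
Qed.

Lemma mu_ge0 i : 0 <= mu i.
Proof. by case: (boolP (leN i N)) => [/mu_gt0/ltW|/mu_out ->]. Qed.

Lemma kappa_gt0 i : leN i.+1 N -> 0 < kappa i.+1.
Proof. by move=> iN; rewrite mulr_gt0 ?mu_gt0 ?a_gt0. Qed.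

Lemma kappa_ge0 i : 0 <= kappa i.
Proof.
case: (boolP (leN i N)) => [iN|/mu_out mi]; last by rewrite /kappa mi mul0r.
case: i iN => [|i] iN; first by rewrite /kappa a_0 mulr0.
exact/ltW/kappa_gt0.
Qed.

(** * Hardy and Poincare inequalities on finite segments *)

Definition wsum (u : nat -> R) n := \sum_(0 <= i < n) mu i * u i.

Lemma wsumS u n : wsum u n.+1 = wsum u n + mu n * u n.
Proof. by rewrite /wsum big_nat_recr. Qed.

(* [h i = kappa i * w i] is a positive supersolution of the dual chain on
   edges, so that the dual form dominates [lam] times its weight. *)
Lemma dual_hardy (lam : R) (w s : nat -> R) M : leN M N ->
  (forall i, leN i.+1 N -> 0 < w i.+1) ->
  (forall i, leN i.+1 N -> lam * w i.+1 <=
     (b i * w i.+1 - a i * w i) - (b i.+1 * w i.+2 - a i.+1 * w i.+1)) ->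
  s 0%N = 0 -> s M.+1 = 0 ->
  lam * (\sum_(0 <= i < M) s i.+1 ^+ 2 / kappa i.+1) <=
  \sum_(0 <= j < M.+1) (s j.+1 - s j) ^+ 2 / mu j.
Proof.
move=> MN w0 wlam s0 sM.
pose h i := kappa i * w i; pose x i := s i ^+ 2 / h i.
pose T i := b i * w i.+1 - a i * w i.
have h_gt0 i : leN i.+1 N -> 0 < h i.+1.
  by move=> iN; rewrite mulr_gt0 ?kappa_gt0 ?w0.
have muT i : ltN i N -> mu i * T i = h i.+1 - h i.
  by move=> iN; rewrite /h kappaS // /T /kappa; ring.
have x0 : x 0%N = 0 by rewrite /x s0 expr0n mul0r.
have xM : x M.+1 = 0 by rewrite /x sM expr0n mul0r.
(* The intermediate sum is bounded below by parts, since [x] vanishes at both ends and [wlam] bounds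
   the decrements of [T], and above term by term through Picone. *)
apply: (@le_trans _ _ (\sum_(0 <= j < M.+1) T j * (x j.+1 - x j))).
  rewrite sum_by_parts x0 xM !mulr0 subrr add0r mulr_sumr.
  apply: ler_sum_nat => i /andP[_ iM].
  have iN : leN i.+1 N := leN_trans _ _ iM MN.
  have w1 := w0 _ iN; have k1 := kappa_gt0 _ iN.
  have -> : lam * (s i.+1 ^+ 2 / kappa i.+1) = x i.+1 * (lam * w i.+1).
    by rewrite /x /h; field; rewrite !gt_eqF.
  by rewrite ler_wpM2l ?wlam // /x divr_ge0 ?sqr_ge0 // ltW ?h_gt0.
apply: ler_sum_nat => j /andP[_]; rewrite ltnS => jM.
have jN : leN j N := leN_trans _ _ jM MN.
have mj := mu_gt0 _ jN; rewrite ler_pdivlMr // mulrC mulrA.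
(* On the last edge [s M.+1 = 0], so for [M > 0] the bound [- h M <= mu M * T M] suffices. It holds
   because [h M.+1 > 0] or, at the top of E, because [b M = 0]. *)
move: jM; rewrite leq_eqVlt => /predU1P[jE|jM].
  rewrite jE in jN mj *; rewrite xM sM !sub0r sqrrN.
  case: M {xM jE} sM MN jN mj => [|M] sM MN _ mj.
    by rewrite x0 s0 oppr0 mulr0 expr0n.
  have h1 := h_gt0 _ MN.
  have : - h M.+1 <= mu M.+1 * T M.+1.
    have [MN'|MN'] := boolP (ltN M.+1 N).
      have := h_gt0 M.+1; rewrite leN_ltN => /(_ MN') ?.
      by rewrite muT // lerBrDl subrr ltW.
    have bM : b M.+1 = 0.
      move: MN' MN; case E : N => [n|] //=; rewrite -leqNgt => ? ?.
      by rewrite (_ : M.+1 = n) ?(b_top _ E) //; apply/eqP; rewrite eqn_leq; apply/andP.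
    by rewrite /T bM mul0r sub0r /h /kappa mulrN mulrA.
  move=> hT; have -> : s M.+1 ^+ 2 = h M.+1 * x M.+1.
    by rewrite /x; field; rewrite gt_eqF.
  have x1 : 0 <= x M.+1 by rewrite divr_ge0 ?sqr_ge0 ?ltW.
  by rewrite mulrN -mulNr ler_wpM2r // lerNl.
have jN' : ltN j N by rewrite -leN_ltN; exact: leN_trans MN.
rewrite muT //.
(* On the first edge [h 0 = 0] and Picone does not apply, but the two sides are then equal. *)
case: j jN' {jN mj} jM => [|j] jN jM.
  rewrite x0 s0 !subr0; have /gt_eqF h1 : 0 < h 1%N by apply: h_gt0.
  by rewrite /x {2}/h /kappa a_0 mulr0 mul0r subr0 mulrC divfK ?h1.
by apply: picone; apply: h_gt0; rewrite ?leN_ltN // -leN_ltN; exact: ltNW.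
Qed.

(* Apply the dual Hardy inequality to the partial sums
   [s i = \sum_(j >= i) mu j * f j] of [f] corrected at the origin to have
   mean zero, then pair with the increments of [f]. *)
Lemma finite_poincare (lam : R) (w f : nat -> R) M : 0 < lam -> leN M N ->
  (forall i, leN i.+1 N -> 0 < w i.+1) ->
  (forall i, leN i.+1 N -> lam * w i.+1 <=
     (b i * w i.+1 - a i * w i) - (b i.+1 * w i.+2 - a i.+1 * w i.+1)) ->
  lam * (wsum (fun i => f i ^+ 2) M.+1 - wsum f M.+1 ^+ 2) <=
  \sum_(0 <= i < M) kappa i.+1 * (f i.+1 - f i) ^+ 2.
Proof.
move=> lam0 MN w0 wlam; set c := wsum f M.+1; set A := wsum _ _.
pose s i := if i is _.+1 then c - wsum f i else 0.
have sM : s M.+1 = 0 by rewrite /s -/c subrr.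
have H := dual_hardy lam w s M MN w0 wlam erefl sM.
(* Since [mu 0 = 1], this is the sum of [mu * f ^ 2] with [f 0] replaced by [f 0 - c]. *)
have E1 : \sum_(0 <= j < M.+1) (s j.+1 - s j) ^+ 2 / mu j
    = A - 2 * c * f 0%N + c ^+ 2.
  rewrite /A /wsum !big_nat_recl //= mu0 /wsum big_nat1 mu0.
  rewrite (_ : \sum_(0 <= i < M) _ =
               \sum_(0 <= i < M) mu i.+1 * f i.+1 ^+ 2); first by rewrite divr1; ring.
  apply: eq_big_nat => i /andP[_ iM].
  have /gt_eqF mi : 0 < mu i.+1 by apply: mu_gt0; exact: leN_trans MN.
  rewrite (big_nat_recr i.+1) //=; field; by rewrite mi.
have E2 : \sum_(0 <= i < M) s i.+1 * (f i.+1 - f i) = A - c * f 0%N.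
  have := sum_by_parts f s M; rewrite sM /= !mulr0 subrr add0r.
  have -> : \sum_(0 <= j < M.+1) f j * (s j.+1 - s j) = c * f 0%N - A.
    rewrite /A /wsum !big_nat_recl //= mu0 /wsum big_nat1 mu0.
    rewrite (_ : \sum_(0 <= i < M) f i.+1 * _ =
      - \sum_(0 <= i < M) mu i.+1 * f i.+1 ^+ 2); first by ring.
    rewrite -sumrN; apply: eq_big_nat => i _.
    by rewrite (big_nat_recr i.+1) //=; ring.
  move=> /(congr1 -%R); rewrite opprB => ->.
  by rewrite -sumrN; apply: eq_bigr => i _; ring.
(* Young's inequality on each edge, weighted by [lam] so that the last sum is the one bounded in
   [H]; on combining with [E1] and [E2] the terms in [c * f 0] cancel. *)
have E3 : 2 * (\sum_(0 <= i < M) s i.+1 * (f i.+1 - f i)) <=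
    lam^-1 * (\sum_(0 <= i < M) kappa i.+1 * (f i.+1 - f i) ^+ 2) +
    lam * (\sum_(0 <= i < M) s i.+1 ^+ 2 / kappa i.+1).
  rewrite !mulr_sumr -big_split /=; apply: ler_sum_nat => i /andP[_ iM].
  have k1 : 0 < kappa i.+1 by apply: kappa_gt0; exact: leN_trans MN.
  rewrite -subr_ge0; set d := f i.+1 - f i; set t := s i.+1.
  have -> : lam^-1 * (kappa i.+1 * d ^+ 2) + lam * (t ^+ 2 / kappa i.+1)
      - 2 * (t * d) = (kappa i.+1 * d - lam * t) ^+ 2 / (lam * kappa i.+1).
    by field; rewrite !gt_eqF.
  by rewrite divr_ge0 ?sqr_ge0 // mulr_ge0 // ltW.
rewrite -ler_pdivlMl //.
by rewrite E1 in H; rewrite E2 in E3; lra.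
Qed.


(** * Series over E as limits of real sequences *)

Lemma sum_leN (F : nat -> R) k n : (forall i, ~~ leN i N -> F i = 0) ->
  (\sum_(k <= i < n | leN i N) (F i)%:E)%E = (\sum_(k <= i < n) F i)%:E.
Proof.
move=> F0; rewrite sumEFin big_mkcond; congr EFin.
by apply: eq_bigr => i _; case: ifPn => // /F0.
Qed.

Lemma eseries_leN (F : nat -> R) l k : (forall i, ~~ leN i N -> F i = 0) ->
  series F @ \oo --> l ->
  (\sum_(k <= i <oo | leN i N) (F i)%:E)%E = (l - \sum_(0 <= i < k) F i)%:E.
Proof.
move=> F0 Fl; apply: cvg_lim => //=.
apply: (@cvg_trans _ (EFin \o (fun n => series F n - series F k) @ \oo)).
  apply: near_eq_cvg; near=> n; rewrite sum_leN //=; congr EFin.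
  by rewrite sub_series_geq //; near: n; exact: nbhs_infty_ge.
by apply/fine_cvgP; split; [exact: nearW|apply: cvgB => //; exact: cvg_cst].
Unshelve. all: by end_near. Qed.

Lemma eseries_leN_cvg (F : nat -> R) : (forall i, ~~ leN i N -> F i = 0) ->
  (forall i, 0 <= F i) ->
  (\sum_(0 <= i <oo | leN i N) (F i)%:E < +oo)%E -> cvgn (series F).
Proof.
move=> F0 Fge0 Foo; apply: nnseries_is_cvg => //; move: Foo.
rewrite eseries_mkcond; congr (_ < _)%E; apply: eq_eseriesr => i _.
by case: ifPn => // /F0 ->.
Qed.

Lemma series_bounded_cvg (F : nat -> R) B : (forall i, 0 <= F i) ->
  (forall n, series F n <= B) -> exists2 l, series F @ \oo --> l & l <= B.
Proof.
move=> F0 FB; exists (limn (series F)).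
  apply: nondecreasing_is_cvgn.
    by apply/nondecreasing_seqP => n; rewrite seriesSr lerDl.
  by exists B => _ [n _ <-].
apply: limr_le; last exact: nearW.
apply: nondecreasing_is_cvgn.
  by apply/nondecreasing_seqP => n; rewrite seriesSr lerDl.
by exists B => _ [n _ <-].
Qed.

Lemma wsumE u : wsum u = series (fun i => mu i * u i).
Proof. by []. Qed.

Lemma wsumD u v n : wsum (fun i => u i + v i) n = wsum u n + wsum v n.
Proof. by rewrite /wsum -big_split; apply: eq_bigr => i _; rewrite mulrDr. Qed.

Lemma wsumZ k u n : wsum (fun i => k * u i) n = k * wsum u n.
Proof. by rewrite /wsum mulr_sumr; apply: eq_bigr => i _; rewrite mulrCA. Qed.

Lemma wsum_cvgD u v A B : wsum u @ \oo --> A -> wsum v @ \oo --> B ->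
  wsum (fun i => u i + v i) @ \oo --> A + B.
Proof.
by move=> uA vB; under eq_cvg do rewrite wsumD; exact: cvgD.
Qed.

Lemma wsum_cvgZ k u A : wsum u @ \oo --> A ->
  wsum (fun i => k * u i) @ \oo --> k * A.
Proof. by move=> uA; under eq_cvg do rewrite wsumZ; apply: cvgMr. Qed.

Definition mass : R := limn (wsum (fun=> 1)).

Lemma wsum1E : wsum (fun=> 1) = series mu.
Proof. by apply/funext => n; apply: eq_bigr => i _; rewrite mulr1. Qed.

Lemma mu_series_cvg : wsum (fun=> 1) @ \oo --> mass.
Proof.
rewrite /mass wsum1E.
by apply: eseries_leN_cvg => //; [exact: mu_out|exact: mu_ge0].
Qed.

Lemma mu_tail m :
  (\sum_(m <= i <oo | leN i N) (mu i)%:E)%E = (mass - wsum (fun=> 1) m)%:E.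
Proof.
rewrite (eseries_leN mu mass m mu_out); last first.
  by rewrite -wsum1E; exact: mu_series_cvg.
by congr (_ - _)%:E; apply: eq_bigr => i _; rewrite mulr1.
Qed.

Lemma total_massE : total_mass N b a = mass%:E.
Proof. by rewrite /total_mass mu_tail /wsum big_geq // subr0. Qed.

Lemma wsum_cst k : wsum (fun=> k) @ \oo --> k * mass.
Proof.
rewrite (_ : (fun=> k) = (fun i : nat => k * (fun=> 1) i)).
  exact/wsum_cvgZ/mu_series_cvg.
by apply/funext => i; rewrite mulr1.
Qed.

(** The two sides are the tails of the series from [k] on, so they compare term by term. *)
Lemma wsum_le_tail {u v : nat -> R} {A B : R} k :
  wsum u @ \oo --> A -> wsum v @ \oo --> B ->
  (forall i, (k <= i)%N -> leN i N -> u i <= v i) ->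
  A - wsum u k <= B - wsum v k.
Proof.
move=> uA vB uv.
have vu : (fun n => wsum v n - wsum v k - (wsum u n - wsum u k)) @ \oo -->
    B - wsum v k - (A - wsum u k).
  by apply: cvgB; apply: cvgB => //; exact: cvg_cst.
rewrite -subr_ge0; apply: (cvgr_to_ge vu).
near=> n; have kn : (k <= n)%N by near: n; exact: nbhs_infty_ge.
rewrite subr_ge0 !wsumE !sub_series_geq //; apply: ler_sum_nat => i /andP[ki _].
case: (boolP (leN i N)) => [iN|/mu_out ->]; last by rewrite !mul0r.
by rewrite ler_wpM2l ?mu_ge0 // uv.
Unshelve. all: by end_near. Qed.

Lemma wsum_dominated u v : (forall i, leN i N -> `|u i| <= v i) ->
  cvgn (wsum v) -> cvgn (wsum u).
Proof.
move=> uv cv; rewrite wsumE; apply: normed_cvg.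
have uv' i : `|mu i * u i| <= mu i * v i.
  rewrite normrM (ger0_norm (mu_ge0 i)).
  case: (boolP (leN i N)) => [iN|/mu_out ->]; last by rewrite !mul0r.
  by rewrite ler_wpM2l ?mu_ge0 // uv.
apply: (series_le_cvg _ _ uv' cv) => i //; exact: le_trans (uv' i).
Qed.

Lemma mass_gt k : ltN k N -> wsum (fun=> 1) k.+1 < mass.
Proof.
move=> kN; have := wsum_le_tail k.+2 (wsum_cst 0) mu_series_cvg _.
move=> /(_ (fun _ _ _ => ler01)).
have -> : wsum (fun=> 0) k.+2 = 0 by apply: big1 => i _; rewrite mulr0.
rewrite mul0r subrr subr_ge0; apply: lt_le_trans.
by rewrite [ltRHS]wsumS mulr1 ltrDl mu_gt0 ?leN_ltN.
Qed.

Lemma mass_gt0 : 0 < mass.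
Proof.
by apply: lt_trans (mass_gt 0 _); rewrite -?leN_ltN // wsumS /wsum big_geq // mu0 mulr1.
Qed.

Lemma mu_intE u A : wsum u @ \oo --> A -> mu_int N b a u = A%:E.
Proof.
move=> uA; rewrite /mu_int (eseries_leN (fun i => mu i * u i) A) //.
  by rewrite big_geq // subr0.
by move=> i /mu_out ->; rewrite mul0r.
Qed.

(** Writing the limit as [c * mass] names the mean [c]; later lemmas take integrability in this
    form. *)
Lemma pi_intE u c : wsum u @ \oo --> c * mass -> pi_int N b a u = c%:E.
Proof.
move=> uA; rewrite /pi_int (eseries_leN (fun i => pi_ N b a i * u i) c).
- by rewrite big_geq // subr0.
- by move=> i /mu_out mi; rewrite /pi_ mi !mul0r.
have -> : c = mass^-1 * (c * mass).
  by rewrite mulrC mulfK // gt_eqF ?mass_gt0.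
rewrite (_ : (fun i => pi_ N b a i * u i) = (fun i => mu i * (mass^-1 * u i))).
  by rewrite -wsumE; exact: wsum_cvgZ.
by apply/funext => i; rewrite /pi_ total_massE /= mulrA.
Qed.

(** Since [|f| <= 1 + f ^ 2] and the total mass is finite, a square integrable function has a
    mean. *)
Lemma inL2_cvg f : inL2 N b a f ->
  (exists A : R, wsum (fun i => f i ^+ 2) @ \oo --> A) /\
  (exists c : R, wsum f @ \oo --> c * mass).
Proof.
move=> f2; have c2 : cvgn (wsum (fun i => f i ^+ 2)).
  apply: eseries_leN_cvg => // i; first by move=> /mu_out ->; rewrite mul0r.
  by rewrite mulr_ge0 ?mu_ge0 ?sqr_ge0.
split; first by exists (limn (wsum (fun i => f i ^+ 2))).
exists (limn (wsum f) / mass); rewrite divfK ?gt_eqF ?mass_gt0 //.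
apply: (@wsum_dominated _ (fun i => 1 + f i ^+ 2)).
  by move=> i _; have := sqr_ge0 (`|f i| - 1); have := real_normK (num_real (f i)); nra.
apply/cvg_ex; exists (mass + limn (wsum (fun i => f i ^+ 2))).
by apply: wsum_cvgD => //; exact: mu_series_cvg.
Qed.

Lemma inL2_of_cvg f (A : R) : wsum (fun i => f i ^+ 2) @ \oo --> A -> inL2 N b a f.
Proof. by move=> fA; rewrite /inL2 (mu_intE _ _ fA) ltry. Qed.


(** With [M] the minimum of [n] and [N], bounds proved for segments inside E hold along the whole
    sequence of partial sums. *)
Lemma sum_cap n : exists2 M, leN M N &
  forall F : nat -> R, (forall i, ~~ leN i N -> F i = 0) ->
  \sum_(0 <= i < n.+1) F i = \sum_(0 <= i < M.+1) F i.
Proof.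
have [nN|nN] := boolP (leN n N); first by exists n.
move: nN; case E : N => [k|] //; rewrite /= -ltnNge => kn; exists k => // F F0.
rewrite (big_cat_nat (n := k.+1)) ?ltnS 1?ltnW //=.
rewrite [X in _ + X = _](_ : _ = 0) ?addr0 // big_nat big1 //.
by move=> i /andP[ki _]; rewrite F0 //= -ltnNge.
Qed.

(** * The Dirichlet form and the lower bound for [lambda1] *)

Definition edge_energy f i : R := kappa i * (f i - f i.-1) ^+ 2.

Lemma edge_energy_ge0 f i : 0 <= edge_energy f i.
Proof. by rewrite mulr_ge0 ?kappa_ge0 ?sqr_ge0. Qed.

Lemma edge_energy_out f i : ~~ leN i N -> edge_energy f i = 0.
Proof. by move=> iN; rewrite /edge_energy /kappa mu_out // !mul0r. Qed.

Lemma edge_energy0 f : edge_energy f 0%N = 0.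
Proof. by rewrite /edge_energy /kappa a_0 mulr0 mul0r. Qed.

Lemma series_edge_energy f n :
  series (edge_energy f) n.+1 =
  \sum_(0 <= i < n) kappa i.+1 * (f i.+1 - f i) ^+ 2.
Proof. by rewrite /series /= big_nat_recl //= edge_energy0 add0r. Qed.

Lemma dirichletE f (d : R) : series (edge_energy f) @ \oo --> d ->
  dirichlet N b a f = d%:E.
Proof.
move=> fd; rewrite /dirichlet (eseries_leN (edge_energy f) d) //.
  by rewrite big_nat1 edge_energy0 subr0.
exact: edge_energy_out.
Qed.

Lemma dirichlet_cvg f : (dirichlet N b a f < +oo)%E ->
  exists d : R, series (edge_energy f) @ \oo --> d.
Proof.
move=> foo; exists (limn (series (edge_energy f))).
apply: eseries_leN_cvg; [exact: edge_energy_out|exact: edge_energy_ge0|].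
apply: le_lt_trans foo; rewrite nneseries_recl ?edge_energy0 ?add0e //.
  by move=> i _; rewrite lee_fin edge_energy_ge0.
exact: leN_trans N_ge1.
Qed.

Lemma lambda1_ge0 : (0 <= lambda1 N b a)%E.
Proof.
apply/ereal_infP => _ [f _ <-]; apply: nneseries_ge0 => i _ _.
by rewrite lee_fin; exact: edge_energy_ge0.
Qed.

(** The supersolution [w] gives the finite Poincare inequality at every level. In the limit the
    normalisation of [f] turns its left side into [lam]. *)
Lemma lambda1_ge (lam : R) (w : nat -> R) : 0 < lam ->
  (forall i, leN i.+1 N -> 0 < w i.+1) ->
  (forall i, leN i.+1 N -> lam * w i.+1 <=
     (b i * w i.+1 - a i * w i) - (b i.+1 * w i.+2 - a i.+1 * w i.+1)) ->
  (lam%:E <= lambda1 N b a)%E.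
Proof.
move=> lam0 w0 wlam; apply/ereal_infP => _ [f [[f2 fD] fmean fnorm] <-].
have [[A fA] [c fc]] := inL2_cvg _ f2.
have [d fd] := dirichlet_cvg _ fD; rewrite (dirichletE _ _ fd) lee_fin.
move: fmean fnorm; rewrite (mu_intE _ _ fA) (mu_intE _ _ fc) => -[cm0] [A1].
rewrite cm0 in fc; rewrite A1 in fA.
have H n : lam * (wsum (fun i => f i ^+ 2) n.+1 - wsum f n.+1 ^+ 2) <=
    series (edge_energy f) n.+1.
  have [M MN E] := sum_cap n.
  have muE u : wsum u n.+1 = wsum u M.+1.
    by apply: E => i /mu_out ->; rewrite mul0r.
  rewrite !muE (_ : series _ n.+1 = series (edge_energy f) M.+1).
    rewrite series_edge_energy; exact: finite_poincare MN w0 wlam.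
  by apply: E; exact: edge_energy_out.
have L : (fun n => lam * (wsum (fun i => f i ^+ 2) n.+1 - wsum f n.+1 ^+ 2)) @ \oo
    --> lam * (1 - 0 ^+ 2).
  apply: cvgMr; apply: cvgB; first by move: fA; rewrite -cvg_shiftS.
  by rewrite !expr2; apply: cvgM; move: fc; rewrite -cvg_shiftS.
have -> : lam = lam * (1 - 0 ^+ 2) by rewrite expr0n subr0 mulr1.
rewrite -subr_ge0.
have DL : (fun n => series (edge_energy f) n.+1 -
   lam * (wsum (fun i => f i ^+ 2) n.+1 - wsum f n.+1 ^+ 2)) @ \oo
   --> d - lam * (1 - 0 ^+ 2).
  by apply: cvgB => //; move: fd; rewrite -cvg_shiftS.
by apply: (cvgr_to_ge DL); apply: nearW => n; rewrite subr_ge0.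
Qed.

(** * Flows of nondecreasing functions and the upper bound for [lambda1] *)

Definition nondecr (f : nat -> R) := forall i, leN i.+1 N -> f i <= f i.+1.

Lemma nondecr_le {f i j} : nondecr f -> (i <= j)%N -> leN j N -> f i <= f j.
Proof.
move=> fnd; elim: j => [|j IHj]; first by rewrite leqn0 => /eqP ->.
rewrite leq_eqVlt => /predU1P[-> //|]; rewrite ltnS => ij jN.
by apply: le_trans (fnd _ jN); apply: IHj => //; exact: leN_trans jN.
Qed.

Lemma incr_nondecr f : incr_on (leN ^~ N) f -> nondecr f.
Proof.
by move=> fi i iN; apply/ltW/fi => //; exact: leN_trans iN.
Qed.

(* [flow c f i] is the sum over [j >= i] of [mu j * (f j - c)] when [c] is the
   mean of [f]. *)
Definition flow c (f : nat -> R) i : R := wsum (fun j => c - f j) i.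

Lemma flowS c f i : flow c f i.+1 = flow c f i + mu i * (c - f i).
Proof. exact: wsumS. Qed.

Lemma flow0 c f : flow c f 0%N = 0.
Proof. by rewrite /flow /wsum big_geq. Qed.

Lemma flowE c f i : flow c f i = c * wsum (fun=> 1) i - wsum f i.
Proof.
rewrite /flow (_ : (fun j => _) = (fun j => c * (fun=> 1) j + (-1) * f j)).
  by rewrite wsumD !wsumZ mulN1r.
by apply/funext => j; rewrite mulr1 mulN1r.
Qed.

(* [mass * flow c f i] is the sum of [mu j * mu k * (f k - f j)] over
   [j < i <= k]; the bound is its term [j = 0, k = i]. *)
Lemma flow_ge f c i : nondecr f -> wsum f @ \oo --> c * mass -> leN i.+1 N ->
  mu i.+1 * (f i.+1 - f 0%N) <= mass * flow c f i.+1.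
Proof.
move=> fnd fc iN; rewrite flowE.
have H1 : f i.+1 * mass - f i.+1 * wsum (fun=> 1) i.+1 <= c * mass - wsum f i.+1.
  have := wsum_le_tail i.+1 (wsum_cst (f i.+1)) fc.
  rewrite (_ : wsum (fun=> f i.+1) i.+1 = f i.+1 * wsum (fun=> 1) i.+1); last first.
    by rewrite -wsumZ; apply: eq_bigr => j _; rewrite mulr1.
  apply => j ij jN; exact: nondecr_le.
have H2 : f i.+1 - f 0%N <= f i.+1 * wsum (fun=> 1) i.+1 - wsum f i.+1.
  rewrite -flowE /flow /wsum big_nat_recl // mu0 mul1r lerDl big_nat sumr_ge0 //.
  move=> j ji; rewrite mulr_ge0 ?mu_ge0 // subr_ge0.
  by apply: nondecr_le => //; rewrite ltnW // ltnS; case/andP: ji.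
have H3 : mu i.+1 <= mass - wsum (fun=> 1) i.+1.
  have := wsum_le_tail i.+2 (wsum_cst 0) mu_series_cvg (fun _ _ _ => ler01).
  rewrite (wsumS (fun=> 1)) mulr1 (_ : wsum (fun=> 0) _ = 0).
    by rewrite mul0r subr0; lra.
  by apply: big1 => j _; rewrite mulr0.
have H4 : 0 <= wsum (fun=> 1) i.+1 by apply: sumr_ge0 => j _; rewrite mulr_ge0 ?mu_ge0.
have H5 := mu_ge0 i.+1.
have H6 : f 0%N <= f i.+1 by apply: nondecr_le.
(* Replacing each [f k] with [k > i] by its lower bound [f i.+1] makes the double sum factor into
   this product. *)
apply: (@le_trans _ _ ((mass - wsum (fun=> 1) i.+1) *
    (f i.+1 * wsum (fun=> 1) i.+1 - wsum f i.+1))).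
  by apply: ler_pM => //; rewrite subr_ge0.
by move: H1; rewrite -subr_ge0 => H1; have := mulr_ge0 H4 H1; lra.
Qed.

Lemma flow_gt0 {f c i} : nondecr f -> f 0%N < f 1%N -> wsum f @ \oo --> c * mass ->
  leN i.+1 N -> 0 < flow c f i.+1.
Proof.
move=> fnd f01 fc iN; have := flow_ge _ _ _ fnd fc iN.
move=> /(lt_le_trans _) H; rewrite -(pmulr_rgt0 _ mass_gt0); apply: H.
rewrite mulr_gt0 ?mu_gt0 // subr_gt0.
by apply: (lt_le_trans f01); exact: nondecr_le.
Qed.

(** The terms [mu j * (f j - c)] sum to zero over E, so their tail from [i.+1] is minus the sum
    below it, which is the flow. *)
Lemma opI_invE f c i : wsum f @ \oo --> c * mass -> leN i.+1 N ->
  f i <= f i.+1 -> 0 < flow c f i.+1 ->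
  ((opI N b a (fbar N b a f) i.+1)^-1 =
   (kappa i.+1 * (f i.+1 - f i) / flow c f i.+1)%:E)%E.
Proof.
move=> fc iN fi S0; rewrite /opI /fbar (pi_intE _ _ fc) /=.
have -> : (\sum_(i.+1 <= j <oo | leN j N) (mu j)%:E * ((f j)%:E - c%:E) =
    (flow c f i.+1)%:E)%E.
  under eq_eseriesr do rewrite -EFinB -EFinM.
  rewrite (eseries_leN (fun j => mu j * (f j - c)) 0).
  - rewrite sub0r -sumrN; congr EFin; apply: eq_bigr => j _.
    by rewrite -mulrN opprB.
  - by move=> j /mu_out ->; rewrite mul0r.
  have := wsum_cvgD _ _ _ _ fc (wsum_cst (- c)).
  by rewrite mulNr subrr.
rewrite -!EFinB -EFinM (_ : f i.+1 - c - (f i - c) = f i.+1 - f i); last by ring.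
rewrite -/(kappa i.+1); have k0 := kappa_gt0 _ iN.
(* A zero increment makes [opI] equal to [+oo] because the flow is positive; its inverse 0 agrees
   with the real quotient. *)
move: fi; rewrite le_eqVlt => /predU1P[->|fi].
  by rewrite subrr mulr0 mul0r inve0 gt0_mulye ?lte_fin.
have d0 : 0 < kappa i.+1 * (f i.+1 - f i) by rewrite mulr_gt0 // subr_gt0.
rewrite inver gt_eqF // -EFinM inver mulf_eq0 invr_eq0 !gt_eqF //=.
by rewrite invfM invrK.
Qed.


(** Multiply the hypothesis by the increments of [f] and sum: by parts, the flow side becomes the
    variance up to a boundary term. Hence [f - c], once normalised, is a test function with energy
    at most [lam]. *)
Lemma lambda1_le f c (lam : R) : inL2 N b a f -> nondecr f -> f 0%N < f 1%N ->
  wsum f @ \oo --> c * mass ->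
  (forall i, leN i.+1 N ->
     kappa i.+1 * (f i.+1 - f i) <= lam * flow c f i.+1) ->
  (lambda1 N b a <= lam%:E)%E.
Proof.
move=> f2 fnd f01 fc flam; have [[A fA] _] := inL2_cvg _ f2.
pose q j := (f j - c) ^+ 2.
have [V qV] : exists V : R, wsum q @ \oo --> V.
  exists (A + (- (2 * c) * (c * mass) + c ^+ 2 * mass)).
  rewrite (_ : q = fun j => f j ^+ 2 + (- (2 * c) * f j + (fun=> c ^+ 2) j)).
    apply: wsum_cvgD => //; apply: wsum_cvgD; [exact: wsum_cvgZ|exact: wsum_cst].
  by apply/funext => j; rewrite /q; ring.
have tail_q M : 0 <= V - wsum q M.
  have := wsum_le_tail M (wsum_cst 0) qV (fun _ _ _ => sqr_ge0 _).
  rewrite mul0r sub0r (_ : wsum (fun=> 0) M = 0) ?oppr0 //.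
  by apply: big1 => j _; rewrite mulr0.
have V0 : 0 < V.
  have := tail_q 1%N; rewrite subr_ge0; apply: lt_le_trans.
  have := flow_gt0 fnd f01 fc N_ge1; rewrite flowS flow0 wsumS /wsum big_geq //.
  by rewrite mu0 !add0r !mul1r /q => cf; nra.
(* The boundary term is absorbed by the tail of the variance. If [f M < c] and [M.+1] is in E, it is
   negative; if [f M >= c], monotonicity gives [(f M - c) * (f j - c) <= q j] for [j > M]; at the
   top there is no such [j]. *)
have tail_flow M : leN M N -> (f M - c) * flow c f M.+1 <= V - wsum q M.+1.
  move=> MN; have [[M1 fMc]|H] : (leN M.+1 N /\ f M - c < 0) \/
      (forall j, (M < j)%N -> leN j N -> (f M - c) * (f j - c) <= q j).
  - case: (boolP (leN M.+1 N)) => M1; last first.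
      by right => j Mj jN; rewrite (leN_trans _ _ Mj jN) in M1.
    case: (ltP (f M - c) 0) => fMc; [by left|right => j Mj jN].
    have fMj : f M <= f j by apply: nondecr_le => //; exact: ltnW.
    by rewrite /q expr2 ler_wpM2r //; lra.
  - apply: le_trans (tail_q _).
    by have := flow_gt0 fnd f01 fc M1; move: (flow _ _ _) => F; nra.
  have fc0 : wsum (fun j => (f M - c) * (f j - c)) @ \oo -->
      (f M - c) * (c * mass + (- c) * mass).
    by apply/wsum_cvgZ/wsum_cvgD => //; exact: wsum_cst.
  have := wsum_le_tail M.+1 fc0 qV H; rewrite wsumZ mulNr subrr mulr0 sub0r.
  rewrite (_ : wsum (fun j => f j - c) M.+1 = - flow c f M.+1) ?mulrN ?opprK //.
  by rewrite /flow /wsum -sumrN; apply: eq_bigr => j _; rewrite -mulrN opprB.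
have energy M : leN M N -> series (edge_energy f) M.+1 <= lam * V.
  move=> MN; rewrite series_edge_energy.
  have S i : leN i.+1 N -> 0 < flow c f i.+1 by exact: flow_gt0.
  have lam0 : 0 < lam.
    rewrite -(pmulr_lgt0 _ (S _ N_ge1)); apply: lt_le_trans (flam _ N_ge1).
    by rewrite mulr_gt0 ?kappa_gt0 // subr_gt0.
  apply: (@le_trans _ _ (lam * \sum_(0 <= i < M) flow c f i.+1 * (f i.+1 - f i))).
    rewrite mulr_sumr; apply: ler_sum_nat => i /andP[_ iM].
    have iN : leN i.+1 N := leN_trans _ _ iM MN.
    by rewrite expr2 !mulrA ler_wpM2r ?flam // subr_ge0 fnd.
  rewrite ler_pM2l //.
  have := sum_by_parts (fun j => f j - c) (flow c f) M.
  rewrite flow0 mulr0 subr0.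
  rewrite [X in X = _](_ : _ = - wsum q M.+1); last first.
    rewrite /wsum -sumrN; apply: eq_bigr => j _; rewrite flowS /q; ring.
  rewrite (_ : \sum_(0 <= i < M) _ = - \sum_(0 <= i < M) flow c f i.+1 * (f i.+1 - f i)).
    by have := tail_flow _ MN; lra.
  by rewrite -sumrN; apply: eq_bigr => i _; ring.
have [|d fd dV] := series_bounded_cvg _ (lam * V) (edge_energy_ge0 f).
  move=> n; apply: (@le_trans _ _ (series (edge_energy f) n.+1)).
    by rewrite seriesSr lerDl edge_energy_ge0.
  have [M MN E] := sum_cap n.
  by rewrite [leLHS](E _ (edge_energy_out f)); exact: energy.
pose s := Num.sqrt V; have s0 : s != 0 by rewrite gt_eqF // sqrtr_gt0.
have s2 : s ^+ 2 = V by rewrite sqr_sqrtr // ltW.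
pose g j := s^-1 * (f j - c).
have g2 : wsum (fun j => g j ^+ 2) @ \oo --> (1 : R).
  rewrite -(mulVf (lt0r_neq0 V0)).
  rewrite (_ : (fun j => _) = (fun j => V^-1 * q j)); first exact: wsum_cvgZ.
  by apply/funext => j; rewrite /g exprMn exprVn s2.
have gd : series (edge_energy g) @ \oo --> V^-1 * d.
  rewrite (_ : series _ = fun n => V^-1 * series (edge_energy f) n).
    exact: cvgMr.
  apply/funext => n; rewrite /series /= mulr_sumr; apply: eq_bigr => i _.
  by rewrite /edge_energy /g -s2; field.
apply: (@le_trans _ _ (V^-1 * d)%:E); last by rewrite lee_fin ler_pdivrMl // mulrC.
apply: ereal_inf_lbound; exists g; last exact: dirichletE.
split; [split| |].
- exact: inL2_of_cvg g2.
- by rewrite (dirichletE _ _ gd) ltry.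
- rewrite (mu_intE _ 0) // -(mulr0 s^-1) -(subrr (c * mass)) -mulNr.
  by apply/wsum_cvgZ/wsum_cvgD => //; exact: wsum_cst.
- exact: mu_intE.
Qed.

(** * The lower bound in the difference form *)

Lemma opRE (d v : nat -> R) i : (forall j, i = j.+1 -> v j != 0) ->
  opR b d v i = (d i.+1 + b i - (if i is j.+1 then d i / v j else 0)
                 - b i.+1 * v i)%:E.
Proof.
by case: i => [|i] vi; rewrite /opR // inver (negPf (vi i erefl)).
Qed.

Lemma lee_real_lower (x y : \bar R) :
  (forall z : R, (z%:E <= x)%E -> (z%:E <= y)%E) -> (x <= y)%E.
Proof.
case: x => [r H|H|_]; [exact: H| |by rewrite leNye].
rewrite leye_eq; apply/eqP; apply: eq_infty => r; apply: H; exact: leey.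
Qed.

Lemma lee_real_upper (x y : \bar R) :
  (forall z : R, (y <= z%:E)%E -> (x <= z%:E)%E) -> (x <= y)%E.
Proof.
case: y => [r H|_|H]; [exact: H|by rewrite leey|].
rewrite leeNy_eq; apply/eqP; apply: eq_ninfty => r; apply: H; exact: leNye.
Qed.

(** Products of the ratios [v] give a positive [w] with [w i.+2 = w i.+1 * v i], and [lam <= R_i(v)]
    multiplied by [w i.+1] is the supersolution inequality of [lambda1_ge]. *)
Lemma inf_opR_le v : setV N v ->
  (ereal_inf [set opR b a v i | i in [set i | ltN i N]] <= lambda1 N b a)%E.
Proof.
move=> v0; apply: lee_real_lower => lam /ereal_infP H.
have [lam0|lam0] := leP lam 0.
  by apply: le_trans lambda1_ge0; rewrite lee_fin.
pose w i := \prod_(j < i.-1) v j.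
have w0 i : leN i.+1 N -> 0 < w i.+1.
  move=> iN; apply: prodr_gt0 => -[j /= ji] _; apply: v0.
  by rewrite -leN_ltN; exact: leN_trans iN.
apply: (lambda1_ge lam w) => // i iN.
have iN' : ltN i N by rewrite -leN_ltN.
have vN0 j : i = j.+1 -> v j != 0.
  by move=> ij; rewrite gt_eqF // v0 // -ij.
have : (lam%:E <= opR b a v i)%E by apply: H; exists i.
rewrite (opRE _ _ _ vN0) lee_fin; set q := (X in _ - X - _) => {}H.
have wS : w i.+2 = w i.+1 * v i by rewrite /w /= big_ord_recr.
have aw : a i * w i = q * w i.+1.
  rewrite {}/q in H *; case: i {iN iN' H wS} vN0 => [|i] vi; first by rewrite a_0 !mul0r.
  have {}vi := vi _ erefl.
  by rewrite {2}/w /= big_ord_recr /= -/(w i.+1); field.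
rewrite wS aw; have := w0 _ iN; move: (w i.+1) => x x0.
by have := ler_wpM2r (ltW x0) H; lra.
Qed.


(** * The Poisson equation and the passage between [R] and [I^-1] *)

Lemma flow_const_tail {f c k} x : wsum f @ \oo --> c * mass ->
  (forall i, (k <= i)%N -> leN i N -> f i = x) ->
  flow c f k = (x - c) * (mass - wsum (fun=> 1) k).
Proof.
move=> fc fx; rewrite flowE.
have wx : wsum (fun=> x) k = x * wsum (fun=> 1) k.
  by rewrite -wsumZ; apply: eq_bigr => j _; rewrite mulr1.
have H1 := wsum_le_tail k (wsum_cst x) fc (fun i ki iN =>
  eq_ind_r (fun y => x <= y) (lexx x) (fx i ki iN)).
have H2 := wsum_le_tail k fc (wsum_cst x) (fun i ki iN =>
  eq_ind_r (fun y => y <= x) (lexx x) (fx i ki iN)).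
have {H1 H2} : x * mass - wsum (fun=> x) k = c * mass - wsum f k.
  by apply/eqP; rewrite eq_le H1 H2.
rewrite wx; lra.
Qed.

Lemma flow_out {f c k} : wsum f @ \oo --> c * mass -> ~~ leN k N ->
  flow c f k = 0.
Proof.
move=> fc kN; rewrite (flow_const_tail c fc) ?subrr ?mul0r // => i ki iN.
by rewrite (leN_trans _ _ ki iN) in kN.
Qed.

Lemma flow_ge0 {f c} k : nondecr f -> f 0%N < f 1%N ->
  wsum f @ \oo --> c * mass -> 0 <= flow c f k.
Proof.
move=> fnd f01 fc; case: k => [|k]; first by rewrite flow0.
by case: (boolP (leN k.+1 N)) => kN; [exact/ltW/flow_gt0|rewrite flow_out].
Qed.

(** These are the increments of the solution [g] of the Poisson equation [- L g = f - c], as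
    [generator_grad] shows. *)
Definition grad c f i : R := flow c f i / kappa i.

Lemma aM_grad c f i : leN i N -> a i * grad c f i = flow c f i / mu i.
Proof.
case: i => [|i] iN; first by rewrite a_0 flow0 !mul0r.
have ai := a_gt0 _ (ltn0Sn i) iN; have mi := mu_gt0 _ iN.
by rewrite /grad /kappa; field; rewrite !gt_eqF.
Qed.

Lemma bM_grad c f i : ltN i N -> b i * grad c f i.+1 = flow c f i.+1 / mu i.
Proof.
move=> iN; have bi := b_gt0 _ iN; have mi := mu_gt0 _ (ltNW _ _ iN).
by rewrite /grad kappaS //; field; rewrite !gt_eqF.
Qed.

Lemma generator_grad f c i : wsum f @ \oo --> c * mass -> leN i N ->
  b i * grad c f i.+1 - a i * grad c f i = c - f i.
Proof.
move=> fc iN; have mi := mu_gt0 _ iN; rewrite aM_grad //.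
have [iN'|iN'] := boolP (ltN i N).
  by rewrite bM_grad // flowS; field; rewrite gt_eqF.
(* At the top of E the equation survives because the flow past the top vanishes along with [b i]. *)
have bi : b i = 0.
  move: iN iN'; case E : N => [n|] //= ni; rewrite -leqNgt => ni'.
  by rewrite (_ : i = n) ?(b_top _ E) //; apply/eqP; rewrite eqn_leq ni.
have : flow c f i.+1 = 0 by apply: flow_out; rewrite ?leN_ltN.
rewrite flowS => H; rewrite bi mul0r sub0r.
have -> : flow c f i = - (mu i * (c - f i)) by lra.
by field; rewrite gt_eqF.
Qed.

Section GradRatio.
Context {f : nat -> R} {c : R}.
Hypotheses (fnd : nondecr f) (f01 : f 0%N < f 1%N)
  (fc : wsum f @ \oo --> c * mass).

Definition grad_ratio i : R := grad c f i.+2 / grad c f i.+1.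

Lemma grad_gt0 i : leN i.+1 N -> 0 < grad c f i.+1.
Proof. by move=> iN; rewrite divr_gt0 ?flow_gt0 ?kappa_gt0. Qed.

Lemma grad_ratio_gt0 i : ltN i.+1 N -> 0 < grad_ratio i.
Proof. by move=> iN; rewrite divr_gt0 ?grad_gt0 ?leN_ltN // -leN_ltN ltNW. Qed.

Lemma aV_grad_ratio i : leN i.+1 N ->
  (if i is j.+1 then a i / grad_ratio j else 0) = a i * grad c f i / grad c f i.+1.
Proof.
case: i => [|i] iN; first by rewrite a_0 !mul0r.
have iN' : leN i.+1 N by exact: leN_trans iN.
have := grad_gt0 _ iN; have := grad_gt0 _ iN' => g0 g1.
by rewrite /grad_ratio; field; rewrite !gt_eqF.
Qed.

(** Subtracting the Poisson equations at [i] and [i.+1] expresses [f i.+1 - f i] through [grad];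
    division by [grad c f i.+1] produces [R]. *)
Lemma opR_grad_ratio i : leN i.+1 N ->
  a i.+1 + b i - (if i is j.+1 then a i / grad_ratio j else 0)
    - b i.+1 * grad_ratio i =
  kappa i.+1 * (f i.+1 - f i) / flow c f i.+1.
Proof.
move=> iN; rewrite aV_grad_ratio // /grad_ratio.
have g0 := grad_gt0 _ iN.
have iN' : leN i N by exact: leN_trans iN.
have T0 := generator_grad _ _ _ fc iN'; have T1 := generator_grad _ _ _ fc iN.
have -> : kappa i.+1 * (f i.+1 - f i) / flow c f i.+1 =
    (f i.+1 - f i) / grad c f i.+1.
  by rewrite /grad; field; rewrite !gt_eqF ?kappa_gt0 ?flow_gt0.
have -> : f i.+1 - f i = (b i * grad c f i.+1 - a i * grad c f i) -
   (b i.+1 * grad c f i.+2 - a i.+1 * grad c f i.+1) by rewrite T0 T1; ring.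
by field; rewrite gt_eqF.
Qed.

Lemma grad_ratio_setV : setV N grad_ratio.
Proof. by move=> i; exact: grad_ratio_gt0. Qed.

Lemma opR_eq_opI i : ltN i N ->
  opR b a grad_ratio i = ((opI N b a (fbar N b a f) i.+1)^-1)%E.
Proof.
move=> iN; have iN' : leN i.+1 N by rewrite leN_ltN.
rewrite opRE; last by move=> j ij; rewrite gt_eqF // grad_ratio_gt0 // -ij.
by rewrite opR_grad_ratio // (opI_invE _ c) ?fnd ?flow_gt0.
Qed.

Definition trunc_ratio m i : R := if (i.+2 <= m)%N then grad_ratio i else 0.

Section Truncated.
Variable m : nat.
Hypotheses (m2 : (2 <= m)%N) (mN : leN m N)
  (f_incr : forall i, (i < m)%N -> f i < f i.+1)
  (f_stop : forall i, (m <= i)%N -> leN i N -> f i = f m).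

(** The upper bound on [v i] says that [R_i] is positive, that is, [f i < f i.+1]. The lower bound,
    cleared of denominators, has margin [f i.+2 - f i.+1] plus a nonnegative multiple of the flow at
    [i.+3]. *)
Lemma trunc_ratio_setVt : setVt N b a (m, trunc_ratio m).
Proof.
split => //=; split=> [i im|i mi]; last by rewrite /trunc_ratio ltnNge mi.
have iN : leN i.+2 N := leN_trans _ _ im mN.
have iN' : leN i.+1 N := leN_trans _ _ (leqnSn _) iN.
have b1 : 0 < b i.+1 by apply: b_gt0; rewrite -leN_ltN.
have g1 := grad_gt0 _ iN'; have g2 := grad_gt0 _ iN.
rewrite {1}/trunc_ratio im; split.
  rewrite ltr_pdivrMr ?addr_gt0 ?a_gt0 // /grad_ratio mulrAC ltr_pdivlMr //.
  have T := generator_grad _ _ _ fc iN'.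
  have A := aM_grad c f _ iN.
  have m0 := mu_gt0 _ iN.
  have F : flow c f i.+2 / mu i.+2 = flow c f i.+3 / mu i.+2 + (f i.+2 - c).
    by rewrite (flowS _ _ i.+2); field; rewrite gt_eqF.
  have F0 : 0 <= flow c f i.+3 / mu i.+2 by rewrite divr_ge0 ?flow_ge0 // ltW.
  have := f_incr _ im; lra.
have -> : (if i is j.+1 then a i / trunc_ratio m j else 0) =
          (if i is j.+1 then a i / grad_ratio j else 0).
  by case: i im {iN iN' b1 g1 g2} => // i im; rewrite /trunc_ratio (ltnW im).
rewrite /trunc_ratio im ltr_pdivlMr // mulrC -subr_gt0 opR_grad_ratio //.
by rewrite divr_gt0 ?flow_gt0 // mulr_gt0 ?kappa_gt0 // subr_gt0 f_incr // ltnW.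
Qed.

(** For [i < m] the two sides are equal; for [i >= m] the zero of [v] at [i.-1] makes [R~] equal to
    [-oo]. *)
Lemma opRt_trunc_ratio i : ltN i N ->
  (opRt N b a m (trunc_ratio m) i <=
   (opI N b a (fbar N b a f) i.+1)^-1)%E.
Proof.
move=> iN; have iN' : leN i.+1 N by rewrite leN_ltN.
have Zm : 0 < mass - wsum (fun=> 1) m.
  case: m m2 mN => // k _ kN; rewrite subr_gt0; apply: mass_gt.
  by rewrite -leN_ltN.
have am : a_tilde N b a m m = kappa m / (mass - wsum (fun=> 1) m).
  by rewrite /a_tilde eqxx mu_tail.
have am0 : 0 < a_tilde N b a m m.
  by rewrite am divr_gt0 //; case: m m2 mN => // k _ kN; exact: kappa_gt0.
rewrite /opRt; have [mi|im] := leqP m i.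
  suff -> : opR b (a_tilde N b a m) (trunc_ratio m) i = -oo%E by exact: leNye.
  case: i iN iN' mi => [|i] iN iN' mi; first by move: m2; rewrite ltnNge ltnW // ltnS.
  have ai : 0 < a_tilde N b a m i.+1.
    rewrite /a_tilde; case: eqP => _; first by move: am0; rewrite /a_tilde eqxx.
    by apply: a_gt0 => //; exact: ltNW.
  by rewrite /opR /trunc_ratio ltnNge mi /= inve0 gt0_muley ?lte_fin.
have vE j : i = j.+1 -> trunc_ratio m j = grad_ratio j.
  by move=> ij; rewrite /trunc_ratio -ij im.
rewrite opRE; last first.
  by move=> j ij; rewrite (vE j ij) gt_eqF // grad_ratio_gt0 // -ij.
rewrite (opI_invE _ c) ?fnd ?flow_gt0 // lee_fin -opR_grad_ratio //.
have -> : (if i is j.+1 then a_tilde N b a m i / trunc_ratio m j else 0) =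
          (if i is j.+1 then a i / grad_ratio j else 0).
  case: i {iN iN'} im vE => // i im vE.
  by rewrite (vE i erefl) /a_tilde ltn_eqF.
(* Only [i.+1 = m] involves the modified rate. As [f] is constant from [m] on, its flow at [m] is
   [f m - c] times the tail mass; hence the lumped rate equals [a m - b m * grad_ratio i], which
   makes up for the truncated [v i = 0]. *)
move: im; rewrite leq_eqVlt => /predU1P[im|im]; last first.
  by rewrite /a_tilde /trunc_ratio im ltn_eqF.
rewrite im am /trunc_ratio -im ltnn mulr0 subr0 [leRHS]addrAC.
rewrite -(addrA (a i.+1)) -subr_ge0.
have g0 := grad_gt0 _ iN'.
have T := generator_grad _ _ _ fc iN'.
have fl := flow_const_tail (f m) fc f_stop.
rewrite -im in fl Zm T *.
have -> : kappa i.+1 / (mass - wsum (fun=> 1) i.+1) = (f i.+1 - c) / grad c f i.+1.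
  rewrite /grad fl; have := grad_gt0 _ iN'; rewrite /grad fl.
  move: Zm; move: (_ - _) (f i.+1 - c) => Z x Z0.
  have k0 := kappa_gt0 _ iN'.
  move=> /lt0r_neq0; rewrite !mulf_eq0 !negb_or => /andP[/andP[x0 _] _].
  by field; rewrite x0 !gt_eqF.
rewrite le_eqVlt; apply/orP; left; apply/eqP.
have -> : f i.+1 - c = - (b i.+1 * grad c f i.+2 - a i.+1 * grad c f i.+1).
  by rewrite T; ring.
set q := (X in _ = _ - X - _); set q' := (X in _ = _ - (_ - X)).
have -> : q' = q by [].
by rewrite /grad_ratio; field; rewrite gt_eqF.
Qed.

End Truncated.
End GradRatio.


(** * Bounds in the summation form *)

Lemma wsum_cvg_mean {f} : cvgn (wsum f) -> exists c : R, wsum f @ \oo --> c * mass.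
Proof.
by move=> cf; exists (limn (wsum f) / mass); rewrite divfK // gt_eqF ?mass_gt0.
Qed.

(** With a finite mean this is the difference form at [grad_ratio]. With an infinite mean [fbar] is
    constantly [-oo], so the term [i = 1] is 0 and [lambda1_ge0] concludes. *)
Lemma inf_opI_le f : setFI N f ->
  (ereal_inf [set (opI N b a (fbar N b a f) i)^-1%E
              | i in [set i | (1 <= i)%N && leN i N]] <= lambda1 N b a)%E.
Proof.
move=> [f0 fpos /[dup] fi /incr_nondecr fnd].
have f01 : f 0%N < f 1%N by apply: fi => //; exact: leN_trans N_ge1.
have [foo|foo] := ltP (pi_int N b a f) +oo%E.
  have [c fc] : exists c : R, wsum f @ \oo --> c * mass.
    apply: wsum_cvg_mean; apply/cvg_ex.
    exists (mass * limn (series (fun i => pi_ N b a i * f i))).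
    have -> : wsum f = wsum (fun i => mass * (mass^-1 * f i)).
      by congr wsum; apply/funext => i; rewrite mulrA divff ?mul1r ?gt_eqF ?mass_gt0.
    apply: wsum_cvgZ.
    rewrite wsumE (_ : (fun i => _) = (fun i => pi_ N b a i * f i)); last first.
      by apply/funext => i; rewrite /pi_ total_massE /= mulrA.
    apply: eseries_leN_cvg => // i.
      by move=> /mu_out mi; rewrite /pi_ mi !mul0r.
    case: (boolP (leN i N)) => [iN|/mu_out mi]; last by rewrite /pi_ mi !mul0r.
    rewrite /pi_ total_massE; apply: mulr_ge0.
      by rewrite divr_ge0 ?mu_ge0 // ltW ?mass_gt0.
    by rewrite -f0; exact: nondecr_le.
  apply: le_trans (inf_opR_le _ (grad_ratio_setV fnd f01 fc)).
  apply/ereal_infP => _ [i /= iN <-]; rewrite (opR_eq_opI fnd f01 fc) //.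
  by apply: ereal_inf_lbound; exists i.+1 => //=; rewrite leN_ltN.
apply: le_trans lambda1_ge0; apply: ereal_inf_lbound.
exists 1%N; first by rewrite /= N_ge1.
have fE : fbar N b a f = fun=> -oo%E.
  by apply/funext => i; rewrite /fbar; move: foo; rewrite leye_eq => /eqP ->.
have k1 : (0 < (kappa 1)%:E)%E by rewrite lte_fin kappa_gt0.
have m1 : (0 < (mu 1)%:E)%E by rewrite lte_fin mu_gt0.
rewrite /opI fE /= -/(kappa 1) gt0_muleNy // inveNy.
rewrite [X in (-oo * X)%E](_ : _ = -oo%E) ?mulNyNy ?invey //.
apply: lim_near_cst => //; near=> n.
have n1 : (1 < n)%N by near: n; exact: nbhs_infty_gt.
by rewrite big_ltn_cond // N_ge1 gt0_muleNy // addNye.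
Unshelve. all: by end_near. Qed.

Lemma lt_steps {f : nat -> R} {m i j} : (forall i, (i < m)%N -> f i < f i.+1) ->
  (i < j)%N -> (j <= m)%N -> f i < f j.
Proof.
move=> fS; elim: j => // j IHj; rewrite ltnS leq_eqVlt => /predU1P[-> jm|ij jm].
  exact: fS.
by apply: lt_trans (fS _ jm); apply: IHj => //; exact: ltnW.
Qed.

Lemma incr_on_steps (f : nat -> R) : (forall i, leN i.+1 N -> f i < f i.+1) ->
  incr_on (leN ^~ N) f.
Proof.
move=> fS i j _ jN ij; apply: (lt_steps (m := j)) => // k kj.
by apply: fS; exact: leN_trans jN.
Qed.

(** Membership in [setFIt] with [m] made explicit and strict increase expressed by unit steps
    starting at 0. *)
Definition step_fun m (f : nat -> R) := [/\ f 0%N = 0, leN m N, (1 <= m)%N,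
  forall i, (i < m)%N -> f i < f i.+1 &
  forall i, (m <= i)%N -> leN i N -> f i = f m].

Lemma setFIt_step (f : nat -> R) : setFIt N f -> exists m, step_fun m f.
Proof.
move=> [f0 [m [mN m1 fm fi]]]; exists m; split => // [i im|i mi iN].
  case: i im => [|i] im; first by rewrite f0; have [] := fm _ (ltn0Sn 0) N_ge1.
  by apply: fi => //=; rewrite ?im // ltnW.
by have [-> _] := fm i (leq_trans m1 mi) iN; rewrite (minn_idPr mi).
Qed.

Section StepFun.
Context {m : nat} {f : nat -> R}.
Hypothesis fm : step_fun m f.

Lemma step_fun_nondecr : nondecr f.
Proof.
have [_ _ _ fS fx] := fm; move=> i iN; have [mi|im] := leqP m i; last exact/ltW/fS.
by rewrite (fx i) ?(fx i.+1) //; [exact: leqW|exact: leN_trans iN].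
Qed.

Lemma step_fun01 : f 0%N < f 1%N.
Proof. by have [_ _ m1 fS _] := fm; exact: fS. Qed.

Lemma step_fun_bounds i : leN i N -> 0 <= f i <= f m.
Proof.
have [f0 mN m1 fS fx] := fm; move=> iN.
rewrite -[X in X <= _]f0 (nondecr_le step_fun_nondecr (leq0n i) iN) /=.
have [im|mi] := leqP i m; first by apply: nondecr_le => //; exact: step_fun_nondecr.
by rewrite (fx i) // ltnW.
Qed.

Lemma step_fun_mean : exists c : R, wsum f @ \oo --> c * mass.
Proof.
apply: wsum_cvg_mean; apply: (@wsum_dominated _ (fun=> f m)).
  by move=> i /step_fun_bounds /andP[f0 fi]; rewrite ger0_norm.
by apply/cvg_ex; exists (f m * mass); exact: wsum_cst.
Qed.

Lemma step_fun_inL2 : inL2 N b a f.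
Proof.
have : cvgn (wsum (fun i => f i ^+ 2)).
  apply: (@wsum_dominated _ (fun=> f m ^+ 2)).
    move=> i /step_fun_bounds /andP[f0 fi]; rewrite ger0_norm ?sqr_ge0 //.
    by rewrite ler_pXn2r ?nnegrE // (le_trans f0).
  by apply/cvg_ex; exists (f m ^+ 2 * mass); exact: wsum_cst.
by move=> /cvg_ex[A fA]; exact: inL2_of_cvg fA.
Qed.

Lemma step_fun_setFIt : setFIt N f.
Proof.
have [f0 mN m1 fS fx] := fm; split => //; exists m; split => // [i i1 iN|i j].
  split.
    by have [im|/ltnW mi] := leqP i m; rewrite ?(minn_idPl im) ?(minn_idPr mi) // fx.
  rewrite -f0; apply: (lt_le_trans step_fun01).
  by apply: nondecr_le => //; exact: step_fun_nondecr.
by move=> _ /andP[_ jm] ij; exact: lt_steps jm.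
Qed.

End StepFun.

Lemma lambda1_le_opI f c (lam : R) : inL2 N b a f -> nondecr f ->
  f 0%N < f 1%N -> wsum f @ \oo --> c * mass ->
  (forall i, leN i.+1 N ->
     ((opI N b a (fbar N b a f) i.+1)^-1 <= lam%:E)%E) ->
  (lambda1 N b a <= lam%:E)%E.
Proof.
move=> f2 fnd f01 fc H; apply: (lambda1_le f c) => // i iN.
by move: (H _ iN); rewrite (opI_invE _ c) ?fnd ?lee_fin ?ler_pdivrMr // ?flow_gt0.
Qed.

Lemma sup_opI_ge f : (setFIt N `|` setFIt' N b a) f ->
  (lambda1 N b a <= ereal_sup [set (opI N b a (fbar N b a f) i)^-1%E
                           | i in [set i | (1 <= i)%N && leN i N]])%E.
Proof.
move=> fF; have [f2 fnd f01] : [/\ inL2 N b a f, nondecr f & f 0%N < f 1%N].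
  case: fF => [/setFIt_step[m fm]|[f2 f0 fi]].
    by split; [exact: step_fun_inL2 fm|exact: step_fun_nondecr fm|exact: step_fun01 fm].
  split => //; first exact: incr_nondecr.
  by apply: fi => //; exact: leN_trans N_ge1.
have [_ [c fc]] := inL2_cvg _ f2.
apply: lee_real_upper => lam /ereal_supP H.
by apply: (lambda1_le_opI f c) => // i iN; apply: H; exists i.+1.
Qed.

Lemma wsum_le {u v : nat -> R} n : (forall i, (i < n)%N -> leN i N -> u i <= v i) ->
  wsum u n <= wsum v n.
Proof.
move=> uv; apply: ler_sum_nat => i /andP[_ ni].
case: (boolP (leN i N)) => [iN|/mu_out ->]; last by rewrite !mul0r.
by rewrite ler_wpM2l ?mu_ge0 ?uv.
Qed.

(** * Shooting *)

Section Shooting.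
Variable lam : R.
Hypothesis lam0 : 0 < lam.

(* Shooting for [- L phi = lam * phi] with [phi 0 = -1]: the state after [n]
   steps is the pair of the flux [kappa n * (phi n - phi n.-1)] and [phi n]. *)
Fixpoint shoot n : R * R :=
  if n is k.+1 then
    let h := (shoot k).1 - lam * mu k * (shoot k).2 in
    (h, (shoot k).2 + h / kappa k.+1)
  else (0, -1).

Local Notation flux n := (shoot n).1.
Local Notation phi n := (shoot n).2.

Lemma shoot_wsum n : flux n = - lam * wsum (fun i => phi i) n.
Proof.
elim: n => [|n IHn]; first by rewrite /wsum big_geq // mulr0.
by rewrite wsumS mulrDr -IHn /=; ring.
Qed.

(** After the shift that makes [f 0 = 0], the flux is [lam] times the flow of [f] with 1 in place of
    the mean. Whether the true mean is at most or at least 1 then decides the direction of the bound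
    on [I^-1]. *)
Lemma shoot_flow (f : nat -> R) n : (forall i, (i < n)%N -> f i = phi i + 1) ->
  lam * wsum (fun i => 1 - f i) n = flux n.
Proof.
move=> fE; rewrite shoot_wsum mulNr -mulrN; congr (_ * _).
rewrite /wsum -sumrN; apply: eq_big_nat => i /andP[_ ni].
by rewrite (fE _ ni); ring.
Qed.

Lemma shoot_diff i : leN i.+1 N -> kappa i.+1 * (phi i.+1 - phi i) = flux i.+1.
Proof.
by move=> iN; rewrite /= addrAC subrr add0r mulrC divfK // gt_eqF ?kappa_gt0.
Qed.

Lemma shoot_flux1 : flux 1 = lam.
Proof. by rewrite /= mu0; ring. Qed.

Lemma shoot_setFI : (forall i, leN i N -> 0 < flux i.+1) ->
  exists f c, [/\ setFI N f, wsum f @ \oo --> c * mass &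
    forall i, leN i.+1 N ->
      (lam%:E <= (opI N b a (fbar N b a f) i.+1)^-1)%E].
Proof.
move=> h0; pose f i := phi i + 1.
have fS i : leN i.+1 N -> f i < f i.+1.
  move=> iN; rewrite /f ltrD2r -subr_gt0 -(pmulr_rgt0 _ (kappa_gt0 _ iN)).
  by rewrite shoot_diff // h0 //; exact: leN_trans iN.
have f0 : f 0%N = 0 by rewrite /f /= addNr.
have fi := incr_on_steps _ fS; have fnd := incr_nondecr _ fi.
have f01 := fS _ N_ge1.
(* A positive flux at [M.+1] means [wsum f M.+1 < wsum 1 M.+1 <= mass], so [f] is integrable with
   mean at most 1. *)
have [||l fl lm] := series_bounded_cvg (fun i => mu i * f i) mass.
- move=> i; case: (boolP (leN i N)) => [iN|/mu_out ->]; last by rewrite mul0r.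
  by rewrite mulr_ge0 ?mu_ge0 // -f0; exact: nondecr_le.
- move=> n; rewrite -wsumE; case: n => [|n].
    by rewrite /wsum big_geq // ltW ?mass_gt0.
  have [M MN E] := sum_cap n.
  rewrite /wsum E; last by move=> i /mu_out ->; rewrite mul0r.
  rewrite -/(wsum f M.+1).
  have : lam * wsum (fun i => 1 - f i) M.+1 = flux M.+1 by apply: shoot_flow.
  have -> : wsum (fun i => 1 - f i) M.+1 = wsum (fun=> 1) M.+1 - wsum f M.+1.
    by rewrite -[LHS]/(flow 1 f M.+1) flowE mul1r.
  have := wsum_le_tail M.+1 (wsum_cst 0) mu_series_cvg (fun _ _ _ => ler01).
  rewrite (_ : wsum (fun=> 0) _ = 0) ?mul0r ?subrr; last first.
    by apply: big1 => i _; rewrite mulr0.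
  by move=> hW hE; have := h0 _ MN; rewrite -hE pmulr_rgt0 //; lra.
exists f, (l / mass).
have fc : wsum f @ \oo --> (l / mass) * mass.
  by rewrite divfK ?gt_eqF ?mass_gt0.
split => //.
  split => // i i1 iN; rewrite -f0; apply: (lt_le_trans f01); exact: nondecr_le.
move=> i iN; rewrite (opI_invE _ (l / mass)) ?fnd ?flow_gt0 //.
rewrite lee_fin ler_pdivlMr ?flow_gt0 //.
have -> : f i.+1 - f i = phi i.+1 - phi i by rewrite /f; ring.
rewrite shoot_diff // -(shoot_flow f) // ler_pM2l //.
apply: wsum_le => j _ _; rewrite lerD2r ler_pdivrMr ?mass_gt0 // mul1r //.
Qed.

Lemma shoot_step_fun m : leN m N -> (1 <= m)%N ->
  (forall i, (i < m)%N -> 0 < flux i.+1) -> flux m.+1 <= 0 ->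
  exists f c, [/\ step_fun m f, wsum f @ \oo --> c * mass &
    forall i, leN i.+1 N ->
      ((opI N b a (fbar N b a f) i.+1)^-1 <= lam%:E)%E].
Proof.
move=> mN m1 h0 hm; pose f i := phi (minn i m) + 1.
have fE i : (i <= m)%N -> f i = phi i + 1 by move=> im; rewrite /f (minn_idPl im).
have fx i : (m <= i)%N -> f i = phi m + 1 by move=> im; rewrite /f (minn_idPr im).
have fm : step_fun m f.
  split => //; first by rewrite /f /= min0n addNr.
    move=> i im; have iN : leN i.+1 N := leN_trans _ _ im mN.
    rewrite !fE ?(ltnW im) // ltrD2r -subr_gt0.
    by rewrite -(pmulr_rgt0 _ (kappa_gt0 _ iN)) shoot_diff // h0.
  by move=> i mi _; rewrite !fx.
have [c fc] := step_fun_mean fm.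
have fnd := step_fun_nondecr fm; have f01 := step_fun01 fm.
(* The flux drops from a positive to a nonpositive value across [m], and the drop is
   [lam * mu m * phi m]. *)
have phim : 0 <= phi m.
  case: m m1 h0 hm mN {f fE fx fm fc fnd f01} => // k _ h0 hm mN.
  have hS : flux k.+2 = flux k.+1 - lam * mu k.+1 * phi k.+1 by [].
  have xl : 0 < lam * mu k.+1 by rewrite mulr_gt0 ?mu_gt0.
  rewrite -(pmulr_rge0 _ xl).
  by have := h0 k (ltnSn _); move: hm; rewrite hS; lra.
(* Up to [m] the sum of [mu * f] is at least that of [mu], because the flux at [m.+1] is
   nonpositive; beyond [m], [f] is the constant [phi m + 1 >= 1]. *)
have c1 : 1 <= c.
  rewrite -(ler_pM2r mass_gt0) mul1r.
  have H : mass - wsum (fun=> 1) m.+1 <= c * mass - wsum f m.+1.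
    apply: (wsum_le_tail m.+1 mu_series_cvg fc) => i mi _.
    by rewrite fx ?lerDr // ltnW.
  have : lam * wsum (fun i => 1 - f i) m.+1 = flux m.+1.
    by apply: shoot_flow => i; rewrite ltnS; exact: fE.
  have -> : wsum (fun i => 1 - f i) m.+1 = wsum (fun=> 1) m.+1 - wsum f m.+1.
    by rewrite -[LHS]/(flow 1 f m.+1) flowE mul1r.
  move=> hE; move: hm; rewrite -hE pmulr_rle0 //; lra.
exists f, c; split => // i iN.
rewrite (opI_invE _ c) ?fnd ?flow_gt0 // lee_fin ler_pdivrMr ?flow_gt0 //.
have [mi|im] := leqP m i.
  rewrite (fx i) ?(fx i.+1) ?(leqW mi) // subrr mulr0.
  by rewrite mulr_ge0 ?flow_ge0 // ltW.
rewrite !fE ?(ltnW im) // opprD addrACA subrr addr0 shoot_diff //.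
rewrite -(shoot_flow f) => [|j ji]; last by apply/fE/ltnW/(leq_trans ji).
by rewrite ler_pM2l //; apply: wsum_le => j _ _; rewrite lerD2r.
Qed.

(** This decides when the shooting stops at [m = 1], a value that [setVt] does not admit. *)
Lemma shoot_flux2 : (flux 2 <= 0) = (a 1%N + b 0%N <= lam).
Proof.
have a1 := a_gt0 _ (ltn0Sn 0) N_ge1; have m1 := mu_gt0 _ N_ge1.
have N0 : ltN 0 N by rewrite -leN_ltN.
have := kappaS _ N0; rewrite mu0 mul1r /kappa => mb.
have -> : flux 2 = lam * mu 1 / kappa 1 * (a 1%N + b 0%N - lam).
  by rewrite /= mu0 -mb /kappa; field; rewrite !gt_eqF.
rewrite pmulr_rle0 ?subr_le0 //; apply: divr_gt0; last exact: kappa_gt0.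
exact: mulr_gt0.
Qed.

Lemma shooting :
  (exists f c, [/\ setFI N f, wsum f @ \oo --> c * mass &
    forall i, leN i.+1 N ->
      (lam%:E <= (opI N b a (fbar N b a f) i.+1)^-1)%E]) \/
  (exists m f c, [/\ (lam < a 1%N + b 0%N -> (2 <= m)%N), step_fun m f,
    wsum f @ \oo --> c * mass &
    forall i, leN i.+1 N ->
      ((opI N b a (fbar N b a f) i.+1)^-1 <= lam%:E)%E]).
Proof.
have [h0|] := pselect (forall i, leN i N -> 0 < flux i.+1).
  by left; exact: shoot_setFI.
move=> /existsNP[k /not_implyP[kN /negP]]; rewrite -leNgt => hk; right.
have ex : exists m, leN m N && (flux m.+1 <= 0) by exists k; rewrite kN.
(* The first failure of positivity is the stopping point; it is not 0 because the flux at 1 is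
   [lam]. *)
case: (ex_minnP ex) => m /andP[mN hm] mmin {k kN hk ex}.
have m1 : (1 <= m)%N.
  by case: m hm {mN mmin} => //; rewrite shoot_flux1 leNgt lam0.
have h0 i : (i < m)%N -> 0 < flux i.+1.
  move=> im; rewrite ltNge; apply/negP => hi.
  have := mmin i; rewrite (leN_trans _ _ (ltnW im) mN) hi => /(_ isT).
  by rewrite leqNgt im.
have [f [c [fm fc fI]]] := shoot_step_fun m mN m1 h0 hm.
exists m, f, c; split => // lamlt; rewrite ltn_neqAle m1 andbT.
by apply/eqP => m1'; move: hm; rewrite -m1' shoot_flux2 leNgt lamlt.
Qed.

End Shooting.


(** * The upper bound by [R~] *)

Lemma wsum_eventually_cst {u : nat -> R} {k} x : (forall i, (k <= i)%N -> u i = x) ->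
  wsum u @ \oo --> x * (mass - wsum (fun=> 1) k) + wsum u k.
Proof.
move=> ux; pose y i := u i - x.
have wy : wsum y @ \oo --> wsum y k.
  apply: cvg_near_cst; near=> n.
  have kn : (k <= n)%N by near: n; exact: nbhs_infty_ge.
  apply/eqP; rewrite -subr_eq0 !wsumE sub_series_geq //; apply/eqP.
  rewrite big_nat big1 // => i /andP[ki _].
  by rewrite /y ux // subrr mulr0.
have wx n : wsum (fun=> x) n = x * wsum (fun=> 1) n.
  by rewrite -wsumZ; apply: eq_bigr => j _; rewrite mulr1.
rewrite (_ : wsum u = wsum (fun i => x + y i)); last first.
  by congr wsum; apply/funext => i; rewrite /y; ring.
rewrite (_ : _ + _ = x * mass + wsum y k).
  by apply: wsum_cvgD => //; exact: wsum_cst.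
by rewrite wsumD wx; ring.
Unshelve. all: by end_near. Qed.

(* If [w] are the increments of [g] and [f] is the mean-zero function
   [- L w], extended past [m - 1] by the lumped state [m], then the bound on
   [R~] says that [lam * g - f] is nondecreasing, so its flow is nonnegative. *)
Lemma lambda1_le_opRt m v (lam : R) : setVt N b a (m, v) ->
  (forall i, ltN i N -> (opRt N b a m v i <= lam%:E)%E) ->
  (lambda1 N b a <= lam%:E)%E.
Proof.
move=> [/= m2 mN [vb v0]] H.
have m1 : (1 <= m)%N by exact: ltnW.
have vpos i : (i.+2 <= m)%N -> 0 < v i.
  move=> im; have [+ _] := vb _ im; apply: lt_trans.
  have iN : leN i.+2 N := leN_trans _ _ im mN.
  rewrite divr_gt0 ?addr_gt0 ?a_gt0 ?b_gt0 -?leN_ltN //.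
  exact: leN_trans iN.
pose w i := if i is k.+1 then \prod_(j < k) v j else 0.
have wS i : w i.+2 = w i.+1 * v i by rewrite /w big_ord_recr.
have w_gt0 i : (i < m)%N -> 0 < w i.+1.
  move=> im; apply: prodr_gt0 => -[j /= ji] _; apply: vpos.
  exact: leq_ltn_trans im.
have w_out i : (m <= i)%N -> w i.+1 = 0.
  move=> mi; have mi' : (m.-1 < i)%N by rewrite prednK.
  by rewrite /w (bigD1 (Ordinal mi')) //= v0 ?mul0r // prednK.
pose at_ := a_tilde N b a m.
have Zm : 0 < mass - wsum (fun=> 1) m.
  case: (m) m1 mN => // k _ kN; rewrite subr_gt0; apply: mass_gt.
  by rewrite -leN_ltN.
have atm : at_ m = kappa m / (mass - wsum (fun=> 1) m).
  by rewrite /at_ /a_tilde eqxx mu_tail.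
(* Below [m] this is [L g] for the [g] posed below, with increments [w]; from [m] on it is the value
   for the lumped state. The sum below [m] telescopes to [kappa m * w m], which the tail cancels by
   the choice of the lumped rate. *)
pose e j := if (j < m)%N then b j * w j.+1 - a j * w j else - (at_ m * w m).
have eS i : (i < m)%N -> e i.+1 = b i.+1 * (w i.+1 * v i) - at_ i.+1 * w i.+1.
  move=> im; rewrite /e -wS; case: ltnP => im'.
    by rewrite /at_ /a_tilde ltn_eqF.
  have -> : i.+1 = m by apply/eqP; rewrite eqn_leq im im'.
  by rewrite w_out // mulr0 sub0r.
have wsum_e i : (i <= m)%N -> wsum e i = kappa i * w i.
  elim: i => [|i IHi] im; first by rewrite /wsum big_geq // mulr0.
  rewrite wsumS IHi ?(ltnW im) // /e im kappaS.
    by rewrite /kappa; ring.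
  by rewrite -leN_ltN; exact: leN_trans mN.
have e0 : wsum e @ \oo --> 0.
  have em i : (m <= i)%N -> e i = - (at_ m * w m) by rewrite /e leqNgt => /negPf ->.
  have := wsum_eventually_cst _ em; rewrite wsum_e // atm.
  rewrite (_ : _ + _ = 0) //; field; by rewrite gt_eqF.
pose g i := \sum_(0 <= j < i) w j.+1.
have gS i : g i.+1 - g i = w i.+1 by rewrite /g big_nat_recr //= addrAC subrr add0r.
have gm : step_fun m g.
  split => //; first by rewrite /g big_geq.
    by move=> i im; rewrite -subr_gt0 gS w_gt0.
  elim=> [|i IHi]; first by rewrite leqn0 => /eqP ->.
  rewrite leq_eqVlt => /predU1P[-> //|mi iN].
  have := gS i; rewrite w_out // => /eqP; rewrite subr_eq0 => /eqP ->.
  by apply: IHi => //; exact: leN_trans iN.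
have [c gc] := step_fun_mean gm.
have gnd := step_fun_nondecr gm; have g01 := step_fun01 gm.
pose u j := lam * g j + e j.
have uc : wsum u @ \oo --> (lam * c) * mass.
  by rewrite -[_ * mass]addr0 -mulrA; apply: wsum_cvgD => //; exact: wsum_cvgZ.
(* For [i < m] the increment of [u] is [(lam - R~_i) * w i.+1]; from [m] on [u] is constant. *)
have und : nondecr u.
  move=> i iN; rewrite -subr_ge0 /u opprD addrACA -mulrBr gS.
  have [mi|im] := leqP m i.
    by rewrite w_out // /e !ltnNge mi (leqW mi) /= subrr mulr0 addr0.
  have w1 := w_gt0 _ im.
  have vN0 j : i = j.+1 -> v j != 0.
    by move=> ij; rewrite gt_eqF // vpos // -ij.
  have := H i; rewrite -leN_ltN => /(_ iN).
  rewrite /opRt (opRE _ _ _ vN0) lee_fin; set q := (X in _ - X - _) => Hi.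
  have aw : a i * w i = q * w i.+1.
    rewrite {}/q in Hi *; case: (i) vN0 im => [|j] vj im; first by rewrite a_0 !mul0r.
    by rewrite wS /a_tilde ltn_eqF //; field; exact: vj.
  rewrite eS // /e im aw; have := ler_wpM2r (ltW w1) Hi; rewrite -/at_; lra.
have flow_u i : flow (lam * c) u i = lam * flow c g i - wsum e i.
  rewrite /flow (_ : (fun j => _) = (fun j => lam * (c - g j) + (-1) * e j)).
    by rewrite wsumD !wsumZ mulN1r.
  by apply/funext => j; rewrite /u; ring.
have key i : leN i.+1 N -> (i < m)%N -> kappa i.+1 * w i.+1 <= lam * flow c g i.+1.
  move=> iN im; rewrite -subr_ge0 -wsum_e // -flow_u -(pmulr_rge0 _ mass_gt0).
  apply: le_trans (flow_ge _ _ _ und uc iN).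
  by rewrite mulr_ge0 ?mu_ge0 // subr_ge0; apply: nondecr_le.
have lam0 : 0 < lam.
  rewrite -(pmulr_lgt0 _ (flow_gt0 gnd g01 gc N_ge1)).
  by apply: lt_le_trans (key _ N_ge1 m1); rewrite mulr_gt0 ?kappa_gt0 ?w_gt0.
apply: (lambda1_le g c) => //; first exact: step_fun_inL2 gm.
move=> i iN; rewrite gS; have [mi|im] := leqP m i; last exact: key.
by rewrite w_out // mulr0 mulr_ge0 ?flow_ge0 // ltW.
Qed.

(** * Sharpness: nearly optimal test functions *)

(* The Rayleigh quotient of the indicator function of [i >= 1]. *)
Lemma lambda1_le_indic :
  (lambda1 N b a <= (b 0%N * mass / (mass - 1))%:E)%E.
Proof.
pose f i : R := (0 < i)%N%:R.
have f1 : step_fun 1 f by split => // [[|i] //|[|i] //]; rewrite /f ltr01.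
have N0 : ltN 0 N by rewrite -leN_ltN.
have w1 : wsum (fun=> 1) 1 = 1 by rewrite wsumS /wsum big_geq // mu0 add0r mulr1.
have Z1 : 0 < mass - 1 by have := mass_gt _ N0; rewrite w1 subr_gt0.
have Z0 := mass_gt0.
pose c := (mass - 1) / mass.
have fc : wsum f @ \oo --> c * mass.
  have fx i : (1 <= i)%N -> f i = 1 by rewrite /f => ->.
  have := wsum_eventually_cst _ fx; rewrite w1 mul1r.
  rewrite wsumS /wsum big_geq // /f mulr0 !addr0.
  by rewrite /c divfK // gt_eqF.
have fnd := step_fun_nondecr f1; have f01 := step_fun01 f1.
apply: (lambda1_le f c) => //; first exact: step_fun_inL2 f1.
move=> [|i] iN; last first.
  rewrite /f subrr mulr0 mulr_ge0 ?flow_ge0 // divr_ge0 ?mulr_ge0 ?(ltW Z0) ?(ltW Z1) //.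
  by rewrite ltW ?b_gt0.
rewrite kappaS // mu0 flowS flow0 mu0 /f /c /= le_eqVlt; apply/orP; left; apply/eqP.
by field; rewrite !gt_eqF.
Qed.

(** By [b 0 = mu 1 * a 1] the left side is [b 0 + a 1 * mu 1 / (mass - 1)], and [mass > 1 + mu 1]
    once state 2 exists. With the indicator bound this puts [lambda1] strictly below [a 1 + b 0],
    leaving room to shoot with [m >= 2]. *)
Lemma indic_lt : ltN 1 N -> b 0%N * mass / (mass - 1) < a 1%N + b 0%N.
Proof.
move=> N1; have N0 : ltN 0 N by rewrite -leN_ltN.
have a1 := a_gt0 _ (ltn0Sn 0) N_ge1; have m1 := mu_gt0 _ N_ge1.
have := kappaS _ N0; rewrite mu0 mul1r /kappa => <-.
have : 1 + mu 1 < mass.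
  by have := mass_gt _ N1; rewrite !wsumS /wsum big_geq // mu0 add0r !mulr1.
move=> Z; rewrite ltr_pdivrMr; last by lra.
by nra.
Qed.

(** For [lam > 0] the stopped alternative of [shooting] would force [lambda1 <= lam]. *)
Lemma setFI_approx (lam : R) : (lam%:E < lambda1 N b a)%E ->
  exists f c, [/\ setFI N f, wsum f @ \oo --> c * mass &
    forall i, leN i.+1 N ->
      (lam%:E <= (opI N b a (fbar N b a f) i.+1)^-1)%E].
Proof.
move=> laml; have [lam0|lam0] := leP lam 0; last first.
  case: (shooting lam lam0) => // -[m [f [c [_ fm fc fI]]]].
  have := lambda1_le_opI f c lam (step_fun_inL2 fm) (step_fun_nondecr fm)
    (step_fun01 fm) fc fI.
  by rewrite leNgt laml.
(* For [lam <= 0] any bounded strictly increasing function vanishing at 0 serves, since [I^-1] is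
   nonnegative. *)
pose f i : R := 1 - i.+1%:R^-1.
have fS i : f i < f i.+1 by rewrite ltrD2l ltrN2 ltf_pV2 ?posrE ?ltr0n // ltr_nat.
have f0 : f 0%N = 0 by rewrite /f invr1 subrr.
have fi : incr_on (leN ^~ N) f by apply: incr_on_steps.
have fnd := incr_nondecr _ fi.
have [c fc] : exists c : R, wsum f @ \oo --> c * mass.
  apply: wsum_cvg_mean; apply: (@wsum_dominated _ (fun=> 1)).
    move=> i iN; rewrite ger0_norm; first by rewrite gerBl invr_ge0.
    by rewrite -f0; exact: nondecr_le.
  by apply/cvg_ex; exists mass; exact: mu_series_cvg.
exists f, c; split => // [|i iN].
  split => // i i1 iN; rewrite -f0; apply: (lt_le_trans (fS 0%N)); exact: nondecr_le.
have S := flow_gt0 fnd (fS _) fc iN.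
rewrite (opI_invE _ c) ?fnd // lee_fin (le_trans lam0) // divr_ge0 ?(ltW S) //.
by rewrite mulr_ge0 ?kappa_ge0 // subr_ge0 fnd.
Qed.

(** The unstopped alternative of [shooting] would force [lam <= lambda1] through [inf_opI_le]. *)
Lemma step_fun_approx (lam : R) : (lambda1 N b a < lam%:E)%E ->
  exists m f c, [/\ (lam < a 1%N + b 0%N -> (2 <= m)%N), step_fun m f,
    wsum f @ \oo --> c * mass &
    forall i, leN i.+1 N ->
      ((opI N b a (fbar N b a f) i.+1)^-1 <= lam%:E)%E].
Proof.
move=> laml; have lam0 : 0 < lam.
  by rewrite -lte_fin; exact: le_lt_trans lambda1_ge0 laml.
case: (shooting lam lam0) => // -[f [c [fFI fc fI]]].
suff : (lam%:E <= lambda1 N b a)%E by rewrite leNgt laml.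
apply: le_trans (inf_opI_le _ fFI); apply/ereal_infP => _ [[|i] //= iN <-].
exact: fI.
Qed.

Lemma lee_lt_lower (x y : \bar R) :
  (forall z : R, (z%:E < x)%E -> (z%:E <= y)%E) -> (x <= y)%E.
Proof.
move=> H; apply: lee_real_lower => z zx; apply/lee_subgt0Pr => e e0.
by rewrite -EFinB; apply: H; apply: lt_le_trans zx; rewrite lte_fin ltrBlDr ltrDl.
Qed.

Lemma lee_lt_upper (x y : \bar R) :
  (forall z : R, (y < z%:E)%E -> (x <= z%:E)%E) -> (x <= y)%E.
Proof.
move=> H; apply: lee_real_upper => z zx; apply/lee_addgt0Pr => e e0.
by rewrite -EFinD; apply: H; apply: le_lt_trans zx _; rewrite lte_fin ltrDl.
Qed.

Lemma inf_sup_opRt_le : ltN 1 N ->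
  (ereal_inf [set ereal_sup [set opRt N b a mv.1 mv.2 i | i in [set i | ltN i N]]
              | mv in setVt N b a] <= lambda1 N b a)%E.
Proof.
move=> N1; apply: lee_lt_upper => z lz.
pose k := b 0%N * mass / (mass - 1).
have [l lE] : exists l : R, lambda1 N b a = l%:E.
  move: lambda1_ge0 lambda1_le_indic; case: (lambda1 N b a) => // l _ _.
  by exists l.
have lk : l < a 1%N + b 0%N.
  by apply: le_lt_trans (indic_lt N1); rewrite -lee_fin -lE lambda1_le_indic.
(* This lies strictly above [lambda1], is at most [z], and stays below [a 1 + b 0] so that the
   stopping index is at least 2. *)
pose lam := Num.min z ((l + (a 1%N + b 0%N)) / 2).
have lamz : lam <= z by rewrite /lam ge_min lexx.
have lamk : lam < a 1%N + b 0%N by rewrite /lam gt_min; apply/orP; right; lra.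
have llam : (lambda1 N b a < lam%:E)%E.
  by rewrite lE lte_fin /lam lt_min -lte_fin -lE lz /=; lra.
have [m [f [c [m2 fm fc fI]]]] := step_fun_approx _ llam.
have {}m2 := m2 lamk; have [_ mN _ fS fx] := fm.
have fnd := step_fun_nondecr fm; have f01 := step_fun01 fm.
apply: (@le_trans _ _ lam%:E); last by rewrite lee_fin.
apply: ge_ereal_inf; eexists.
  exists (m, trunc_ratio (f := f) (c := c) m) => //.
  exact: trunc_ratio_setVt fnd f01 fc m m2 mN fS.
apply/ereal_supP => _ [i /= iN <-]; apply: le_trans (fI i _); last by rewrite leN_ltN.
exact: opRt_trunc_ratio.
Qed.

End BirthDeath.

(** * The four equalities *)

Theorem theorem6p1 (R : realType) (N : option nat) (b a : nat -> R)
    (N_ge1 : leN 1 N)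
    (b_gt0 : forall i, ltN i N -> 0 < b i)
    (b_top : forall n, N = Some n -> b n = 0)
    (a_gt0 : forall i, (1 <= i)%N -> leN i N -> 0 < a i)
    (a_0 : a 0%N = 0)
    (mass_fin : (total_mass N b a < +oo)%E) :
  (* N = 1 is excluded from the first equality: then setVt is empty. *)
  (N <> Some 1%N ->
    ereal_inf [set ereal_sup [set opRt N b a mv.1 mv.2 i | i in [set i | ltN i N]]
              | mv in setVt N b a] = lambda1 N b a) /\
  lambda1 N b a =
    ereal_sup [set ereal_inf [set opR b a v i | i in [set i | ltN i N]]
              | v in setV N] /\
  ereal_inf [set ereal_sup [set (opI N b a (fbar N b a f) i)^-1%E
                           | i in [set i | (1 <= i)%N && leN i N]]
            | f in setFIt N `|` setFIt' N b a] = lambda1 N b a /\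
  lambda1 N b a =
    ereal_sup [set ereal_inf [set (opI N b a (fbar N b a f) i)^-1%E
                             | i in [set i | (1 <= i)%N && leN i N]]
              | f in setFI N].
Proof.
split; [|split; [|split]].
- move=> N1; apply/eqP; rewrite eq_le; apply/andP; split.
    apply: inf_sup_opRt_le => //.
    by move: N1 N_ge1; case: (N) => // -[|[|n]].
  apply/ereal_infP => _ [[m v] /= mv <-]; apply: lee_real_upper => lam.
  move=> /ereal_supP H; apply: lambda1_le_opRt mv _ => // i iN.
  by apply: H; exists i.
- apply/eqP; rewrite eq_le; apply/andP; split; last first.
    by apply/ereal_supP => _ [v vV <-]; exact: inf_opR_le.
  apply: lee_lt_lower => lam llam.
  have [f [c [[_ _ fi] fc fI]]] : exists f c, [/\ setFI N f,
      wsum b a f @ \oo --> c * mass b a &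
      forall i, leN i.+1 N ->
        (lam%:E <= (opI N b a (fbar N b a f) i.+1)^-1)%E].
    exact: setFI_approx.
  have fnd := incr_nondecr _ _ fi.
  have f01 : f 0%N < f 1%N by apply: fi => //; exact: leN_trans N_ge1.
  (* The shooting function with [lam <= I^-1] is turned into ratios with [lam <= R] by
     [opR_eq_opI]. *)
  apply: le_trans (ereal_sup_ubound _); last first.
    by exists (grad_ratio b a (f := f) (c := c)) => //; exact: grad_ratio_setV.
  apply/ereal_infP => _ [i /= iN <-]; rewrite (opR_eq_opI N) //.
  by apply: fI; rewrite leN_ltN.
- apply/eqP; rewrite eq_le; apply/andP; split; last first.
    by apply/ereal_infP => _ [f fF <-]; exact: sup_opI_ge.
  apply: lee_lt_upper => lam llam.
  have [m [f [c [_ fm fc fI]]]] : exists m f c,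
    [/\ (lam < a 1%N + b 0%N -> (2 <= m)%N), step_fun N m f,
      wsum b a f @ \oo --> c * mass b a &
      forall i, leN i.+1 N ->
        ((opI N b a (fbar N b a f) i.+1)^-1 <= lam%:E)%E].
    exact: step_fun_approx.
  apply: ge_ereal_inf; eexists.
    by exists f => //; left; exact: step_fun_setFIt fm.
  by apply/ereal_supP => _ [[|i] //= iN <-]; exact: fI.
- apply/eqP; rewrite eq_le; apply/andP; split; last first.
    by apply/ereal_supP => _ [f fF <-]; exact: inf_opI_le.
  apply: lee_lt_lower => lam llam.
  have [f [c [fF _ fI]]] : exists f c, [/\ setFI N f,
      wsum b a f @ \oo --> c * mass b a &
      forall i, leN i.+1 N ->
        (lam%:E <= (opI N b a (fbar N b a f) i.+1)^-1)%E].
    exact: setFI_approx.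
  apply: le_trans (ereal_sup_ubound _); last by exists f.
  by apply/ereal_infP => _ [[|i] //= iN <-]; exact: fI.
Qed.
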